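(* Any $E_\infty$-operad is an Adem-Cartan operad. That is, if $E$ is an $E_\infty$-operad, then $E(2)$ is a $\Sigma_2$-projective resolution of $\mathbb F_2$ and there exists a morphism of operads $m:\mathcal{L}ev^{AC}\to E$ such that $m(2)$ is a quasi-isomorphism.
   Context: The ground field is $\mathbb F_2$; ''vector space'' means differential $\mathbb Z$-graded $\mathbb F_2$-vector space with differential of degree $+1$. A permutation $\sigma\in\Sigma_n$ is written $(\sigma(1)\ldots\sigma(n))$; products are compositions of functions. An operad $\mathcal O=\{\mathcal O(n)\}_{n>0}$ consists of right differential graded $\mathbb F_2[\Sigma_n]$-modules with $\mathcal O(1)=\mathbb F_2$ and associative, unital, equivariant compositions, with $(o\cdot\sigma)(a_1,\ldots,a_n)=o(a_{\sigma^{-1}(1)},\ldots,a_{\sigma^{-1}(n)})\cdot\sigma(i_1,\ldots,i_n)$ (block permutation). Operads form a closed model category: weak equivalences are quasi-isomorphisms, fibrations are epimorphisms, cofibrations have the left lifting property against acyclic fibrations. An $E_\infty$-operad $E$ is a $\Sigma_*$-projective resolution of the operad $\mathcal{C}om$ of commutative associative algebras: each $E(r)$ is $\Sigma_r$-projective and there is an acyclic fibration $E\to\mathcal{C}om$. $\mathcal E$: free operad on the $\Sigma_2$-module with basis over $\mathbb F_2[\Sigma_2]$ given by $e_i$ in degree $-i$, $i\ge0$, $d(e_i)=e_{i-1}+e_{i-1}\cdot(21)$, $e_{i}=0$ for $i<0$. For integers $i,j$, $(i,j)=\frac{(i+j)!}{i!\,j!}\in\mathbb F_2$ if $i,j\ge0$,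 and $0$ otherwise. For $m>0$ with $2^k\le m\le 2^{k+1}-1$, $[u^m_n]_x\in\mathcal E(4)^{-n-x}$ is: $[u^m_n]_x=0$ if $n<0$; $[u^m_0]_x=(e_x\cdot(21)^{m-1})(e_0,e_0)$; and for $n>0$ $$[u^m_n]_x=\sum_{i=0}^{2^{k+1}-1}\ \sum_{\delta:\,0\le 2^{k+1}\delta-i\le n}(n-m+i,m-1)\Big[(i,m)\,(e_x\cdot(21)^{m-1})(e_{2^{k+1}\delta-i},e_{n+i-2^{k+1}\delta})+(i-1,m)\,(e_x\cdot(21)^{m-1})(e_{2^{k+1}\delta-i},e_{n+i-2^{k+1}\delta}\cdot(21))\Big].$$ For $p\in\mathbb Z$, $\alpha_{n,p}=\sum_{s=0}^{n-p}[u^{s+1}_{s+p}]_{n-s-p}+\sum_{s=0}^{n-p-1}[u^{s+1}_{s+p+1}]_{n-s-p-1}\cdot(3412)\in\mathcal E(4)^{-n}$. $\mathcal{L}ev^{AC}$ is the (cofibrant) operad which, forgetting the differential, is the free operad on the $\Sigma_2$-module $\mathcal E(2)$ and the free $\Sigma_4$-module on elements $G^m_n$ of degree $-n$, $n\ge m\ge1$, with differential extending that of $\mathcal E$ and given, with $p=\lfloor\frac{m-1}2\rfloor$ and $G^m_n=0$ if $m\le0$ or $n<m$, by $$dG^m_m=G^{m-1}_{m-1}\cdot(3214)(\mathrm{Id}+(2143))+G^{m-2}_{m-1}\cdot(\mathrm{Id}+(4321))+\alpha_{m-1,m-1-p}+\alpha_{m-1,p}\cdot(3214),$$ $$dG^m_n=G^m_{n-1}\cdot(\mathrm{Id}+(2143))+G^{m-2}_{n-1}\cdot(\mathrm{Id}+(4321))+\alpha_{n-1,n-1-p}+\alpha_{n-1,p}\cdot(3214)\quad(n>m).$$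 An Adem-Cartan operad is an operad $\mathcal O$ such that $\mathcal O(2)$ is a $\Sigma_2$-projective resolution of $\mathbb F_2$, together with a morphism of operads $m:\mathcal{L}ev^{AC}\to\mathcal O$ such that $m(2)$ is a quasi-isomorphism. *)

(* Defs.v *)
From mathcomp Require Import all_boot all_order all_fingroup all_algebra.

Set Implicit Arguments.
Unset Strict Implicit.
Unset Printing Implicit Defensive.

Import GRing.Theory.
Local Open Scope ring_scope.

(* Graded F_2-vector spaces are represented by their total space together with
   its homogeneous components: [homog d] is the subspace of degree [d], and the
   total space is the (internal) direct sum of these subspaces over d : int. *)
Record grVect := GrVect {
  gcar :> lmodType 'F_2;
  homog : int -> gcar -> Prop;
  homog0 : forall d, homog d 0;
  homogP : forall d a x y, homog d x -> homog d y -> homog d (a *: x + y);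
  homog_span : forall x, exists (s : seq int) (f : int -> gcar),
    [/\ uniq s, forall d, homog d (f d) & x = \sum_(d <- s) f d];
  homog_free : forall (s : seq int) (f : int -> gcar),
    uniq s -> (forall d, homog d (f d)) -> \sum_(d <- s) f d = 0 ->
    forall d, d \in s -> f d = 0 }.

(* Right graded F_2[Sigma_n]-modules.  The action law is
   x.(s o t) = (x.s).t with s o t the composition of functions, whereas the
   library's (s * t)%g maps x to t (s x); hence the order of factors in [actM]. *)
Record grMod (n : nat) := GrMod {
  gvect :> grVect;
  act : gvect -> 'S_n -> gvect;
  act_linear : forall s, linear (act^~ s);
  act_homog : forall d x s, homog d x -> homog d (act x s);
  act1 : forall x, act x 1%g = x;
  actM : forall x s t, act x (t * s)%g = act (act x s) t }.

Record dgMod (n : nat) := DgMod {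
  dgraded :> grMod n;
  diff : dgraded -> dgraded;
  diff_linear : linear diff;
  diff_homog : forall d x, homog d x -> homog (d + 1) (diff x);
  diffK : forall x, diff (diff x) = 0;
  diff_act : forall x s, diff (act x s) = act (diff x) s }.

Definition isGrMap n (M N : grMod n) (f : M -> N) : Prop :=
  [/\ linear f,
      forall d x, homog d x -> homog d (f x)
    & forall x s, f (act x s) = act (f x) s].

Definition isDgMap n (M N : dgMod n) (f : M -> N) : Prop :=
  isGrMap f /\ forall x, f (diff x) = diff (f x).

Definition surjective (A B : Type) (f : A -> B) : Prop :=
  forall y, exists x, f x = y.

(* For a map of differential graded modules: injectivity and surjectivity of
   the induced map ker d / im d -> ker d / im d. *)
Definition quasiIso n (M N : dgMod n) (f : M -> N) : Prop :=
  (forall x, diff x = 0 -> (exists y, f x = diff y) -> exists z, x = diff z) /\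
  (forall y, diff y = 0 -> exists x z, diff x = 0 /\ y = f x + diff z).

(* Right F_2[Sigma_n]-modules without grading, used only to express
   projectivity. *)
Record symMod (n : nat) := SymMod {
  scar :> lmodType 'F_2;
  sact : scar -> 'S_n -> scar;
  sact_linear : forall s, linear (sact^~ s);
  sact1 : forall x, sact x 1%g = x;
  sactM : forall x s t, sact x (t * s)%g = sact (sact x s) t }.

Definition isSymMap n (A B : symMod n) (f : A -> B) : Prop :=
  linear f /\ forall x s, f (sact x s) = sact (f x) s.

Definition forgetGr n (M : grMod n) : symMod n :=
  @SymMod n M (@act n M) (@act_linear n M) (@act1 n M) (@actM n M).

(* A graded module is projective iff its total module is, iff each of its
   homogeneous components is. *)
Definition projective n (M : grMod n) : Prop :=
  forall (A B : symMod n) (p : A -> B) (f : forgetGr M -> B),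
    isSymMap p -> surjective p -> isSymMap f ->
    exists2 g : forgetGr M -> A, isSymMap g & forall x, p (g x) = f x.

Section TrivialModule.
Variable n : nat.

Let thomog (d : int) (x : ('F_2)^o) : Prop := d = 0 \/ x = 0.

Fact triv_homog0 d : thomog d 0. Proof. by right. Qed.

Fact triv_homogP d a x y : thomog d x -> thomog d y -> thomog d (a *: x + y).
Proof. by move=> [->|->]; [left | move=> [->|->]; [left | right; rewrite scaler0 addr0]]. Qed.

Fact triv_homog_span x : exists (s : seq int) (f : int -> ('F_2)^o),
  [/\ uniq s, forall d, thomog d (f d) & x = \sum_(d <- s) f d].
Proof.
exists [:: 0], (fun d => if d == 0 then x else 0); split=> //.
  by move=> d; case: eqP => [->|_]; [left | right].
by rewrite big_seq1 eqxx.
Qed.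

Fact triv_homog_free (s : seq int) (f : int -> ('F_2)^o) :
  uniq s -> (forall d, thomog d (f d)) -> \sum_(d <- s) f d = 0 ->
  forall d, d \in s -> f d = 0.
Proof.
move=> us hf hs d ds; rewrite (bigD1_seq d) //= in hs.
have [d0|//] := hf d; rewrite big1 ?addr0 // in hs.
by move=> i; rewrite d0 => /eqP; case: (hf i).
Qed.

Definition trivVect := GrVect triv_homog0 triv_homogP triv_homog_span triv_homog_free.

Let tact (x : trivVect) (s : 'S_n) : trivVect := x.

Fact triv_act_linear s : linear (tact^~ s). Proof. by []. Qed.
Fact triv_act_homog d x s : homog d x -> homog d (tact x s). Proof. by []. Qed.
Fact triv_act1 x : tact x 1%g = x. Proof. by []. Qed.
Fact triv_actM x s t : tact x (t * s)%g = tact (tact x s) t. Proof. by []. Qed.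

Definition trivGrMod := GrMod triv_act_linear triv_act_homog triv_act1 triv_actM.

Let tdiff (x : trivGrMod) : trivGrMod := 0.

Fact triv_diff_linear : linear tdiff.
Proof. by move=> a x y; rewrite /tdiff scaler0 addr0. Qed.
Fact triv_diff_homog d x : homog d x -> homog (d + 1) (tdiff x).
Proof. by right. Qed.
Fact triv_diffK x : tdiff (tdiff x) = 0. Proof. by []. Qed.
Fact triv_diff_act x s : tdiff (act x s) = act (tdiff x) s. Proof. by []. Qed.

(* F_2 in degree 0, with trivial action and zero differential *)
Definition trivMod : dgMod n :=
  DgMod triv_diff_linear triv_diff_homog triv_diffK triv_diff_act.
End TrivialModule.

Definition projResolutionF2 n (M : dgMod n) : Prop :=
  projective M /\
  exists f : M -> trivMod n, [/\ isDgMap f, surjective f & quasiIso f].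

(* For N = k_0 + ... + k_(n-1), [flat eN j] is the position
   k_0 + ... + k_(i-1) + j in {0, ..., N-1} of the j-th element of the i-th
   block.  The total N is a separate variable, so that operadic compositions
   need no transport along equalities of arities. *)
Definition flat n (k : 'I_n -> nat) (N : nat) (eN : N = (\sum_i k i)%N)
  (i : 'I_n) (j : 'I_(k i)) : 'I_N := cast_ord (esym eN) (tagnat.Rank i j).
Arguments flat [n k N] eN [i] j.

Lemma flat_val n (k : 'I_n -> nat) (N : nat) (eN : N = (\sum_i k i)%N)
  (i : 'I_n) (j : 'I_(k i)) :
  flat eN j = (\sum_(l < n | (l < i)%N) k l + j)%N :> nat.
Proof. exact: (tagnat.rankEsum (Tagged _ j)). Qed.

Section BlockPermutations.
Variables (n : nat) (k : 'I_n -> nat) (N : nat) (eN : N = (\sum_i k i)%N).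

Definition sumPermFun (t : forall i, 'S_(k i)) (x : 'I_N) : 'I_N :=
  flat eN (t _ (tagnat.sig2 (cast_ord eN x))).

Fact sumPermFun_inj t : injective (sumPermFun t).
Proof.
move=> x y xy; apply: (@cast_ord_inj _ _ eN); apply: tagnat.sig_inj.
move: xy; rewrite /sumPermFun /tagnat.sig2 /tagnat.sig1.
case: (tagnat.sig (cast_ord eN x)) => i a; case: (tagnat.sig _) => j b /=.
move=> /(congr1 val) /= /eqP; rewrite tagnat.eq_Rank => /andP[/eqP eij].
by case: _ / eij b => b /eqP /val_inj /perm_inj ->.
Qed.

(* the direct sum of permutations: [flat j |-> flat (t i j)] on block i *)
Definition sumPerm (t : forall i, 'S_(k i)) : 'S_N := perm (@sumPermFun_inj t).

Variables (s : 'S_n) (eN' : N = (\sum_i k ((s^-1)%g i))%N).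

Definition blockPermFun (x : 'I_N) : 'I_N :=
  flat eN' (cast_ord (congr1 k (esym (permK s _))) (tagnat.sig2 (cast_ord eN x))).

Fact blockPermFun_inj : injective blockPermFun.
Proof.
move=> x y xy; apply: (@cast_ord_inj _ _ eN); apply: tagnat.sig_inj.
move: xy; rewrite /blockPermFun /tagnat.sig2 /tagnat.sig1.
case: (tagnat.sig (cast_ord eN x)) => i a; case: (tagnat.sig _) => j b /=.
move=> /(congr1 val) /= /eqP; rewrite tagnat.eq_Rank => /andP[/eqP/perm_inj eij].
by case: _ / eij b => b /eqP /= /val_inj ->.
Qed.

(* the block permutation s(k_1, ..., k_n): the i-th block of the decomposition
   N = k_1 + ... + k_n is sent, in order, to the s(i)-th block of
   N = k_(s^-1(1)) + ... + k_(s^-1(n)) *)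
Definition blockPerm : 'S_N := perm blockPermFun_inj.
End BlockPermutations.
Arguments sumPerm [n k N] eN t.
Arguments blockPerm [n k N] eN [s] eN'.

(* Operads O = {O(n)}_(n > 0) of graded F_2-vector spaces with O(1) = F_2.  The
   family is extended by O(0) = 0.  [comp eN o a] is o(a_1, ..., a_n) in O(N),
   where a_i is in O(k_i) and N = k_1 + ... + k_n. *)
Record grOperad := GrOperad {
  op :> forall n : nat, grMod n;
  comp : forall (n : nat) (k : 'I_n -> nat) (N : nat),
    N = (\sum_i k i)%N -> op n -> (forall i, op (k i)) -> op N;
  opunit : op 1%N;
  op0 : forall x : op 0%N, x = 0;
  op1 : opunit != 0 /\ forall x : op 1%N, exists a : 'F_2, x = a *: opunit;
  opunit_homog : homog 0 opunit;
  comp_linearl : forall n k N eN (a : forall i, op (k i)),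
    linear (fun o : op n => @comp n k N eN o a);
  comp_linearr : forall n k N eN (o : op n) (a : forall i, op (k i)) (i : 'I_n),
    linear (fun x : op (k i) => @comp n k N eN o (dfwith a x));
  comp_homog : forall n k N eN (o : op n) (a : forall i, op (k i))
      (d : int) (e : 'I_n -> int),
    homog d o -> (forall i, homog (e i) (a i)) ->
    homog (d + \sum_i e i) (@comp n k N eN o a);
  comp_unitl : forall n (eN : n = (\sum_(i < 1) n)%N) (x : op n),
    @comp 1%N (fun=> n) n eN opunit (fun=> x) = x;
  comp_unitr : forall n (eN : n = (\sum_(i < n) 1)%N) (x : op n),
    @comp n (fun=> 1%N) n eN x (fun=> opunit) = x;
  compA : forall (n : nat) (k : 'I_n -> nat) (N : nat) (eN : N = (\sum_i k i)%N)
      (l : 'I_N -> nat) (M : nat) (eM : M = (\sum_x l x)%N)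
      (m : 'I_n -> nat) (em : forall i, m i = (\sum_j l (flat eN (i := i) j))%N)
      (eM' : M = (\sum_i m i)%N)
      (o : op n) (a : forall i, op (k i)) (b : forall x, op (l x)),
    comp eM (comp eN o a) b =
    comp eM' o (fun i => comp (em i) (a i) (fun j => b (flat eN j)));
  comp_actl : forall (n : nat) (k : 'I_n -> nat) (N : nat) (s : 'S_n)
      (eN : N = (\sum_i k i)%N) (eN' : N = (\sum_i k ((s^-1)%g i))%N)
      (o : op n) (a : forall i, op (k i)),
    comp eN (act o s) a =
    act (comp eN' o (fun i => a ((s^-1)%g i))) (blockPerm eN eN');
  comp_actr : forall (n : nat) (k : 'I_n -> nat) (N : nat)
      (eN : N = (\sum_i k i)%N) (t : forall i, 'S_(k i))
      (o : op n) (a : forall i, op (k i)),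
    comp eN o (fun i => act (a i) (t i)) = act (comp eN o a) (sumPerm eN t) }.
Arguments comp {_} [n k N] eN o a.
Arguments opunit {_}.

Record dgOperad := DgOperad {
  goperad :> grOperad;
  odiff : forall n, goperad n -> goperad n;
  odiff_linear : forall n, linear (@odiff n);
  odiff_homog : forall n d (x : goperad n), homog d x -> homog (d + 1) (odiff x);
  odiffK : forall n (x : goperad n), odiff (odiff x) = 0;
  odiff_act : forall n (x : goperad n) s, odiff (act x s) = act (odiff x) s;
  odiff_comp : forall (n : nat) (k : 'I_n -> nat) (N : nat)
      (eN : N = (\sum_i k i)%N) (o : goperad n) (a : forall i, goperad (k i)),
    odiff (comp eN o a) =
    comp eN (odiff o) a + \sum_i comp eN o (dfwith a (odiff (a i))) }.

Definition dgComponent (O : dgOperad) (n : nat) : dgMod n :=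
  DgMod (@odiff_linear O n) (@odiff_homog O n) (@odiffK O n) (@odiff_act O n).

Definition isGrOperadMap (O P : grOperad) (f : forall n, O n -> P n) : Prop :=
  [/\ forall n, isGrMap (f n),
      f 1%N opunit = opunit
    & forall n (k : 'I_n -> nat) N (eN : N = (\sum_i k i)%N)
        (o : O n) (a : forall i, O (k i)),
      f N (comp eN o a) = comp eN (f n o) (fun i => f (k i) (a i))].

Definition isDgOperadMap (O P : dgOperad) (f : forall n, O n -> P n) : Prop :=
  isGrOperadMap f /\ forall n (x : O n), f n (odiff x) = odiff (f n x).

Definition weakEquivalence (O P : dgOperad) (f : forall n, O n -> P n) : Prop :=
  forall n, quasiIso (M := dgComponent O n) (N := dgComponent P n) (f n).

Definition fibration (O P : dgOperad) (f : forall n, O n -> P n) : Prop :=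
  forall n, surjective (f n).

Section Com.

(* Com(n) is F_2 for n > 0 and Com(0) = 0: row vectors of size [0 < n]. *)
Definition comCar (n : nat) : lmodType 'F_2 := 'rV['F_2]_(0 < n)%N.
Definition comVal n (x : comCar n) : 'F_2 := \sum_j x 0 j.
Definition comMk n (c : 'F_2) : comCar n := const_mx c.

Lemma comVal_linear n a (x y : comCar n) :
  comVal (a *: x + y) = a * comVal x + comVal y.
Proof.
rewrite /comVal mulr_sumr -big_split /=; apply: eq_bigr => j _.
by rewrite !mxE.
Qed.

Lemma comVal0 n : comVal (0 : comCar n) = 0.
Proof. by rewrite /comVal big1 // => j _; rewrite mxE. Qed.

Lemma comMk_linear n a c d : comMk n (a * c + d) = a *: comMk n c + comMk n d.
Proof. by apply/rowP => j; rewrite !mxE. Qed.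

Lemma comMk0 n : comMk n 0 = 0.
Proof. by apply/rowP => j; rewrite !mxE. Qed.

Lemma comValK n c : comVal (comMk n c) = c *+ (0 < n)%N.
Proof.
rewrite /comVal (eq_bigr (fun=> c)) => [|j _]; last by rewrite mxE.
by rewrite sumr_const card_ord.
Qed.

Lemma comMkK n (x : comCar n) : comMk n (comVal x) = x.
Proof.
case: n x => [|n] x; first by apply/rowP => -[].
by apply/rowP => j; rewrite mxE /comVal big_ord1 (ord1 j).
Qed.

Lemma comVal_arity0 (x : comCar 0) : comVal x = 0.
Proof. by rewrite /comVal big_ord0. Qed.

Let chomog n (d : int) (x : comCar n) : Prop := d = 0 \/ x = 0.

Fact com_homog0 n d : @chomog n d 0. Proof. by right. Qed.

Fact com_homogP n d a (x y : comCar n) :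
  chomog d x -> chomog d y -> chomog d (a *: x + y).
Proof. by move=> [->|->]; [left | move=> [->|->]; [left | right; rewrite scaler0 addr0]]. Qed.

Fact com_homog_span n (x : comCar n) : exists (s : seq int) (f : int -> comCar n),
  [/\ uniq s, forall d, chomog d (f d) & x = \sum_(d <- s) f d].
Proof.
exists [:: 0], (fun d => if d == 0 then x else 0); split=> //.
  by move=> d; case: eqP => [->|_]; [left | right].
by rewrite big_seq1 eqxx.
Qed.

Fact com_homog_free n (s : seq int) (f : int -> comCar n) :
  uniq s -> (forall d, chomog d (f d)) -> \sum_(d <- s) f d = 0 ->
  forall d, d \in s -> f d = 0.
Proof.
move=> us hf hs d ds; rewrite (bigD1_seq d) //= in hs.
have [d0|//] := hf d; rewrite big1 ?addr0 // in hs.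
by move=> i; rewrite d0 => /eqP; case: (hf i).
Qed.

Definition comVect n :=
  GrVect (@com_homog0 n) (@com_homogP n) (@com_homog_span n) (@com_homog_free n).

Let cact n (x : comVect n) (s : 'S_n) : comVect n := x.

Fact com_act_linear n s : linear ((@cact n)^~ s). Proof. by []. Qed.
Fact com_act_homog n d (x : comVect n) s : homog d x -> homog d (cact x s).
Proof. by []. Qed.
Fact com_act1 n (x : comVect n) : cact x 1%g = x. Proof. by []. Qed.
Fact com_actM n (x : comVect n) s t : cact x (t * s)%g = cact (cact x s) t.
Proof. by []. Qed.

Definition comMod n : grMod n :=
  GrMod (@com_act_linear n) (@com_act_homog n) (@com_act1 n) (@com_actM n).

Definition comComp n (k : 'I_n -> nat) N (eN : N = (\sum_i k i)%N)
  (o : comMod n) (a : forall i, comMod (k i)) : comMod N :=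
  comMk N (comVal o * \prod_i comVal (a i)).

Definition comUnit : comMod 1 := comMk 1 1.

Fact com_op0 (x : comMod 0) : x = 0.
Proof. by apply/rowP => -[]. Qed.

Fact com_op1 : comUnit != 0 /\ forall x : comMod 1, exists a : 'F_2, x = a *: comUnit.
Proof.
split.
  apply/eqP => /(congr1 (@comVal 1)); rewrite comValK comVal0 mulr1n.
  by move/eqP; rewrite oner_eq0.
move=> x; exists (comVal x); rewrite -[LHS]comMkK -[comVal x]addr0 -[X in X + 0]mulr1.
by rewrite comMk_linear comMk0 !addr0 mulr1.
Qed.

Fact com_unit_homog : homog 0 comUnit. Proof. by left. Qed.

Fact com_comp_linearl n k N eN (a : forall i, comMod (k i)) :
  linear (fun o : comMod n => @comComp n k N eN o a).
Proof. by move=> c x y; rewrite /comComp comVal_linear mulrDl -mulrA comMk_linear. Qed.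

Fact com_comp_linearr n k N eN (o : comMod n) (a : forall i, comMod (k i)) (i : 'I_n) :
  linear (fun x : comMod (k i) => @comComp n k N eN o (dfwith a x)).
Proof.
move=> c x y; rewrite /comComp -comMk_linear; congr comMk.
rewrite !(bigD1 i (P := xpredT)) //= !dfwith_in.
have E (z : comMod (k i)) : \prod_(j | j != i) comVal (dfwith a z j) =
           \prod_(j | j != i) comVal (a j).
  apply: eq_bigr => j ji; have ij : i != j by rewrite eq_sym.
  by rewrite (dfwith_out _ _ ij).
rewrite !E comVal_linear; set p := \prod_(_ | _) _.
by rewrite mulrDl mulrDr !mulrA [c * _]mulrC.
Qed.

Fact com_comp_homog n k N eN (o : comMod n) (a : forall i, comMod (k i))
    (d : int) (e : 'I_n -> int) :
  homog d o -> (forall i, homog (e i) (a i)) ->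
  homog (d + \sum_i e i) (@comComp n k N eN o a).
Proof.
move=> [->|->] ha; last by right; rewrite /comComp comVal0 mul0r comMk0.
have [/forallP h|/forallPn /= [i hi]] := boolP [forall i, e i == 0].
  by left; rewrite big1 ?addr0 // => i _; apply/eqP.
right; rewrite /comComp (bigD1 i) //=; have [e0|->] := ha i.
  by rewrite e0 eqxx in hi.
by rewrite comVal0 mul0r mulr0 comMk0.
Qed.

Fact com_comp_unitl n (eN : n = (\sum_(i < 1) n)%N) (x : comMod n) :
  @comComp 1 (fun=> n) n eN comUnit (fun=> x) = x.
Proof. by rewrite /comComp big_ord1 comValK mulr1n mul1r comMkK. Qed.

Fact com_comp_unitr n (eN : n = (\sum_(i < n) 1)%N) (x : comMod n) :
  @comComp n (fun=> 1%N) n eN x (fun=> comUnit) = x.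
Proof.
by rewrite /comComp big1 ?mulr1 ?comMkK // => i _; rewrite comValK mulr1n.
Qed.

Lemma comVal_comp n k N eN (o : comMod n) (a : forall i, comMod (k i)) :
  comVal (@comComp n k N eN o a) = comVal o * \prod_i comVal (a i).
Proof.
rewrite /comComp comValK; case: ltnP; rewrite ?mulr1n // leqn0 mulr0n => /eqP N0.
have [n0|n_gt0] := posnP n; first by subst n; rewrite comVal_arity0 mul0r.
rewrite N0 in eN; pose i := Ordinal n_gt0.
have /eqP ki : k i == 0%N.
  by move/esym/eqP: eN; rewrite sum_nat_eq0 => /forallP /(_ i).
rewrite (bigD1 i) //=; move: (a i); rewrite ki => x.
by rewrite comVal_arity0 mul0r mulr0.
Qed.

Fact com_compA (n : nat) (k : 'I_n -> nat) (N : nat) (eN : N = (\sum_i k i)%N)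
    (l : 'I_N -> nat) (M : nat) (eM : M = (\sum_x l x)%N)
    (m : 'I_n -> nat) (em : forall i, m i = (\sum_j l (flat eN (i := i) j))%N)
    (eM' : M = (\sum_i m i)%N)
    (o : comMod n) (a : forall i, comMod (k i)) (b : forall x, comMod (l x)) :
  comComp eM (comComp eN o a) b =
  comComp eM' o (fun i => comComp (em i) (a i) (fun j => b (flat eN j))).
Proof.
rewrite {1 2}/comComp -/(comComp eN o a); congr comMk.
rewrite comVal_comp -mulrA; congr (_ * _).
under [RHS]eq_bigr => i _ do rewrite comVal_comp.
rewrite big_split /=; congr (_ * _); rewrite sig_big_dep /=.
rewrite (reindex (fun p : {i : 'I_n & 'I_(k i)} => flat eN (tagged p))) //=.
exists (fun x => tagnat.sig (cast_ord eN x)) => [p|x] _ /=.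
  by rewrite /flat cast_ordKV -tagnat.rankE tagnat.rankK.
by rewrite /flat -tagnat.rankE tagnat.sigK cast_ordK.
Qed.

Fact com_comp_actl (n : nat) (k : 'I_n -> nat) (N : nat) (s : 'S_n)
    (eN : N = (\sum_i k i)%N) (eN' : N = (\sum_i k ((s^-1)%g i))%N)
    (o : comMod n) (a : forall i, comMod (k i)) :
  comComp eN (act o s) a =
  act (comComp eN' o (fun i => a ((s^-1)%g i))) (blockPerm eN eN').
Proof.
by rewrite /comComp /= (reindex_inj (@perm_inj _ (s^-1)%g)).
Qed.

Fact com_comp_actr (n : nat) (k : 'I_n -> nat) (N : nat)
    (eN : N = (\sum_i k i)%N) (t : forall i, 'S_(k i))
    (o : comMod n) (a : forall i, comMod (k i)) :
  comComp eN o (fun i => act (a i) (t i)) = act (comComp eN o a) (sumPerm eN t).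
Proof. by []. Qed.

Definition comGrOperad : grOperad :=
  GrOperad com_op0 com_op1 com_unit_homog com_comp_linearl com_comp_linearr
    com_comp_homog com_comp_unitl com_comp_unitr com_compA com_comp_actl
    com_comp_actr.

Let cdiff n (x : comGrOperad n) : comGrOperad n := 0.

Fact com_diff_linear n : linear (@cdiff n).
Proof. by move=> a x y; rewrite /cdiff scaler0 addr0. Qed.
Fact com_diff_homog n d (x : comGrOperad n) :
  homog d x -> homog (d + 1) (cdiff x).
Proof. by right. Qed.
Fact com_diffK n (x : comGrOperad n) : cdiff (cdiff x) = 0. Proof. by []. Qed.
Fact com_diff_act n (x : comGrOperad n) s : cdiff (act x s) = act (cdiff x) s.
Proof. by []. Qed.
Fact com_diff_comp (n : nat) (k : 'I_n -> nat) (N : nat)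
    (eN : N = (\sum_i k i)%N) (o : comGrOperad n) (a : forall i, comGrOperad (k i)) :
  cdiff (comp eN o a) =
  comp eN (cdiff o) a + \sum_i comp eN o (dfwith a (cdiff (a i))).
Proof.
rewrite /cdiff /= /comComp comVal0 mul0r comMk0 add0r big1 // => i _.
by rewrite (bigD1 i) //= dfwith_in comVal0 mul0r mulr0 comMk0.
Qed.

Definition Com : dgOperad :=
  DgOperad com_diff_linear com_diff_homog com_diffK com_diff_act com_diff_comp.
End Com.

Definition isEinfty (E : dgOperad) : Prop :=
  (forall r, projective (E r)) /\
  exists f : forall n, E n -> Com n,
    [/\ isDgOperadMap f, fibration f & weakEquivalence f].

(* Permutations named by their one-line notation, e.g. s3214 is (3214), which
   is 1 |-> 3, 2 |-> 2, 3 |-> 1, 4 |-> 4; letters are shifted to start from 0. *)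
Definition i2 (k : nat) : 'I_2 := inord k.
Definition i4 (k : nat) : 'I_4 := inord k.
Definition s21 : 'S_2 := tperm (i2 0) (i2 1).
Definition s2143 : 'S_4 := (tperm (i4 0) (i4 1) * tperm (i4 2) (i4 3))%g.
Definition s3214 : 'S_4 := tperm (i4 0) (i4 2).
Definition s3412 : 'S_4 := (tperm (i4 0) (i4 2) * tperm (i4 1) (i4 3))%g.
Definition s4321 : 'S_4 := (tperm (i4 0) (i4 3) * tperm (i4 1) (i4 2))%g.

(* the symbol (i, j) = (i + j)! / (i! j!) mod 2, extended by 0 *)
Definition mbin (i j : int) : 'F_2 :=
  match i, j with
  | Posz a, Posz b => 'C(a + b, a)%:R
  | _, _ => 0
  end.

(* z if z >= 0, else 0: the number of terms of a sum over 0 <= s < z *)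
Definition natz (z : int) : nat := if z is Posz a then a else 0%N.

Section AlphaElements.
Variables (O : grOperad) (e : nat -> O 2%N).

Fact sum22 : 4%N = (\sum_(i < 2) 2)%N.
Proof. by rewrite sum_nat_const card_ord. Qed.

Definition comp2 (o x y : O 2%N) : O 4%N :=
  comp (k := fun=> 2%N) sum22 o (fun i : 'I_2 => if i == ord0 then x else y).

(* e_x for x : int, with e_x = 0 for x < 0 *)
Definition ez (x : int) : O 2%N := if x is Posz a then e a else 0.

(* [u^m_n]_x; here [K] is 2^(k+1), where 2^k <= m <= 2^(k+1) - 1, and delta,
   which is necessarily nonnegative, ranges over i <= K delta <= n + i. *)
Definition uelt (m : nat) (n x : int) : O 4%N :=
  let top := act (ez x) (s21 ^+ m.-1)%g in
  match n with
  | Negz _ => 0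
  | Posz 0 => comp2 top (e 0) (e 0)
  | Posz n' =>
    let K := (2 ^ (trunc_log 2 m).+1)%N in
    \sum_(i < K) \sum_(delta < (n' + i).+1 | (i <= K * delta <= n' + i)%N)
      mbin (n - m%:Z + i%:Z) (m%:Z - 1) *:
        (mbin i m *:
           comp2 top (e (K * delta - i)%N) (e (n' + i - K * delta)%N)
         + mbin (i%:Z - 1) m *:
           comp2 top (e (K * delta - i)%N) (act (e (n' + i - K * delta)%N) s21))
  end.

Definition alpha (n p : int) : O 4%N :=
  \sum_(s < natz (n - p + 1)) uelt s.+1 (s%:Z + p) (n - s%:Z - p)
  + \sum_(s < natz (n - p))
      act (uelt s.+1 (s%:Z + p + 1) (n - s%:Z - p - 1)) s3412.
End AlphaElements.

Section LevGen.
Variables (O : grOperad) (G : nat -> nat -> O 4%N).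

(* G^m_n, with G^m_n = 0 if m <= 0 or n < m; the value 0 at m = 0 makes the
   truncated subtraction of ssrnat harmless in the index m - 2 below *)
Definition Gz (m n : nat) : O 4%N := if (0 < m <= n)%N then G m n else 0.

Definition dG (e : nat -> O 2%N) (m n : nat) : O 4%N :=
  let p := ((m - 1) %/ 2)%N in
  let h := if n == m then act (Gz (m - 1) (m - 1)) s3214 else Gz m (n - 1) in
  (h + act h s2143)
  + (Gz (m - 2) (n - 1) + act (Gz (m - 2) (n - 1)) s4321)
  + alpha e (n%:Z - 1) (n%:Z - 1 - p%:Z)
  + act (alpha e (n%:Z - 1) p) s3214.
End LevGen.

Definition homogeneousGens (O : grOperad) (e : nat -> O 2%N) (G : nat -> nat -> O 4%N) :=
  (forall i : nat, homog (- i%:Z) (e i)) /\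
  (forall m n : nat, (1 <= m <= n)%N -> homog (- n%:Z) (G m n)).

Definition extends (O P : grOperad) (f : forall n, O n -> P n)
    (e : nat -> O 2%N) (G : nat -> nat -> O 4%N)
    (e' : nat -> P 2%N) (G' : nat -> nat -> P 4%N) : Prop :=
  [/\ isGrOperadMap f,
      forall i : nat, f 2%N (e i) = e' i
    & forall m n : nat, (1 <= m <= n)%N -> f 4%N (G m n) = G' m n].

(* O is the free graded operad on the free graded Sigma_2-module on the e_i and
   the free graded Sigma_4-module on the G^m_n, n >= m >= 1: equivariant degree
   preserving maps from these modules to P amount to families e', G' of
   homogeneous elements.  Values [G m n] at other indices are irrelevant. *)
Definition isFreeOn (O : grOperad) (e : nat -> O 2%N) (G : nat -> nat -> O 4%N) : Prop :=
  homogeneousGens e G /\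
  forall (P : grOperad) (e' : nat -> P 2%N) (G' : nat -> nat -> P 4%N),
    homogeneousGens e' G' ->
    (exists f : forall n, O n -> P n, extends f e G e' G') /\
    (forall f g : forall n, O n -> P n,
       extends f e G e' G' -> extends g e G e' G' ->
       forall n (x : O n), f n x = g n x).

(* Lev^AC, determined up to unique isomorphism by its presentation *)
Record levAC := LevAC {
  lev :> dgOperad;
  leve : nat -> lev 2%N;
  levG : nat -> nat -> lev 4%N;
  lev_free : isFreeOn leve levG;
  lev_de : forall i : nat,
    odiff (leve i) = ez leve (i%:Z - 1) + act (ez leve (i%:Z - 1)) s21;
  lev_dG : forall m n : nat, (1 <= m <= n)%N ->
    odiff (levG m n) = dG levG leve m n }.

Definition isAdemCartan (L : levAC) (O : dgOperad) : Prop :=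
  projResolutionF2 (dgComponent O 2%N) /\
  exists2 f : forall n, L n -> O n, isDgOperadMap f &
    quasiIso (M := dgComponent L 2) (N := dgComponent O 2%N) (f 2%N).

(* Main.v *)
Require Import Defs.
From mathcomp Require Import all_boot all_order all_fingroup all_algebra.
From HB Require Import structures.
From mathcomp Require Import boolp.

(** Choose e'_0 in E(2) lifting 1 and solve d e'_i = e'_(i-1) + e'_(i-1).(21) and
    d G'^m_n = dG(e', G') in E by acyclicity of the augmentation E -> Com.  The
    obstruction d(dG(e', G')) vanishes without any computation: dG(e', G') is the
    image of d G^m_n under a map of graded operads L -> E which commutes with d on
    the generators already treated.  The resulting map commutes with d everywhere,
    since the elements on which it does form a suboperad, and a graded suboperad
    of a free operad containing the generators is everything.  The same induction
    shows that L(2) is spanned by the e_i and e_i.(21).  Linear independence of the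
    boundaries e_i + e_i.(21) follows from projectivity of E(2), where every
    invariant is a norm. *)

Set Implicit Arguments.
Unset Strict Implicit.
Unset Printing Implicit Defensive.

Import GRing.Theory Defs.
Local Open Scope ring_scope.

(** * Linear maps and graded vector spaces over F_2 *)

Section LinearMaps.
Variables (V W : lmodType 'F_2) (g : V -> W).
Hypothesis lin_g : linear g.

Lemma linD x y : g (x + y) = g x + g y.
Proof. by have := lin_g 1 x y; rewrite !scale1r. Qed.

Lemma lin0 : g 0 = 0.
Proof. by apply: (addrI (g 0)); rewrite -linD !addr0. Qed.

Lemma linZ c x : g (c *: x) = c *: g x.
Proof. by rewrite -[c *: x]addr0 lin_g lin0 addr0. Qed.

Lemma lin_sum I (r : seq I) (P : pred I) (F : I -> V) :
  g (\sum_(i <- r | P i) F i) = \sum_(i <- r | P i) g (F i).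
Proof. exact: (big_morph g linD lin0). Qed.
End LinearMaps.

Lemma addrr_F2 (V : lmodType 'F_2) (x : V) : x + x = 0.
Proof.
rewrite -[x]scale1r -scalerDl; suff -> : 1 + 1 = 0 :> 'F_2 by rewrite scale0r.
by apply/val_inj.
Qed.

Lemma F2_cases (c : 'F_2) : c = 0 \/ c = 1.
Proof. by case: c => -[|[|//]] h; [left | right]; apply/val_inj. Qed.

Lemma sum_pad (V : zmodType) (s t : seq int) (f : int -> V) :
  uniq s -> uniq t -> {subset s <= t} ->
  \sum_(d <- t) (if d \in s then f d else 0) = \sum_(d <- s) f d.
Proof.
move=> us ut st; rewrite -big_mkcond -big_filter; apply: perm_big.
apply: uniq_perm => //; first exact: filter_uniq.
by move=> d; rewrite mem_filter; case ds: (d \in s); rewrite //= st.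
Qed.

Section GradedSpan.
Variables (V : lmodType 'F_2) (T : int -> V -> Prop).
Hypotheses (T0 : forall d, T d 0)
  (TP : forall d a x y, T d x -> T d y -> T d (a *: x + y)).

(** The shape of [homog_span] with an arbitrary family [T] in place of the homogeneous components,
    so that it can serve as the spanning axiom of a graded subspace. *)
Definition gradedSpan (x : V) : Prop := exists (s : seq int) (f : int -> V),
  [/\ uniq s, forall d, T d (f d) & x = \sum_(d <- s) f d].

Lemma gradedSpan1 d x : T d x -> gradedSpan x.
Proof.
move=> Tx; exists [:: d], (fun e => if e == d then x else 0).
split=> [//|e|]; last by rewrite big_seq1 eqxx.
by case: eqP => [->|_].
Qed.

Lemma gradedSpanP a x y : gradedSpan x -> gradedSpan y -> gradedSpan (a *: x + y).
Proof.
move=> [s [f [us Tf ->]]] [t [g [ut Tg ->]]].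
pose F d := if d \in s then f d else 0; pose G d := if d \in t then g d else 0.
exists (undup (s ++ t)), (fun d => a *: F d + G d); split; first exact: undup_uniq.
- by move=> d; apply: TP; rewrite /F /G; case: ifP.
- rewrite big_split /= -scaler_sumr !sum_pad ?undup_uniq // => d ds;
    by rewrite mem_undup mem_cat ds ?orbT.
Qed.
End GradedSpan.

Lemma homogD (V : grVect) d (x y : V) : homog d x -> homog d y -> homog d (x + y).
Proof. by move=> hx hy; rewrite -[x]scale1r; apply: homogP. Qed.

Lemma homogZ (V : grVect) d a (x : V) : homog d x -> homog d (a *: x).
Proof. by move=> hx; rewrite -[_ *: x]addr0; apply: homogP => //; exact: homog0. Qed.

Lemma homogB (V : grVect) d (x y : V) : homog d x -> homog d y -> homog d (x - y).
Proof. by move=> hx hy; apply: homogD => //; rewrite -scaleN1r; apply: homogZ. Qed.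

Section HomogeneousMaps.
Variables (V W : grVect) (g : V -> W) (c : int).
Hypotheses (lin_g : linear g)
  (g_homog : forall d x, homog d x -> homog (d + c) (g x)).

(** Each [g (f d)] lives in degree [d + c]; as the whole image lies in degree [e + c], directness of
    the sum leaves only the term of index [e]. *)
Lemma homog_coef (s : seq int) (f : int -> V) (e : int) :
  uniq s -> (forall d, homog d (f d)) -> e \in s ->
  homog (e + c) (g (\sum_(d <- s) f d)) -> g (f e) = g (\sum_(d <- s) f d).
Proof.
move=> us hf es; set y := g _ => hy.
(* Indexed by target degrees, this family is homogeneous and sums to [y - y = 0]. *)
pose k d := g (f (d - c)) - (if d == e + c then y else 0).
have: k (e + c) = 0; last by rewrite /k addrK eqxx => /eqP; rewrite subr_eq0 => /eqP.
apply: (@homog_free _ [seq d + c | d <- s] k) (e + c) _.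
- by rewrite map_inj_uniq //; exact: addIr.
- move=> d; apply: homogB; first by rewrite -{1}[d](subrK c); apply: g_homog.
  by case: eqP => [-> //|_]; exact: homog0.
- rewrite big_map sumrB; under eq_bigr do rewrite addrK.
  under [X in _ - X]eq_bigr do rewrite (inj_eq (addIr c)).
  by rewrite -(lin_sum lin_g) -/y [X in _ - X](bigD1_seq e) //= eqxx big1 ?addr0 ?subrr // => d /negPf ->.
- exact: map_f.
Qed.
End HomogeneousMaps.

(** The component is chosen before [g], so a single [x0] serves several maps at once, such as the
    differential and the augmentation. *)
Lemma homog_component (V : grVect) (x : V) (e : int) :
  exists2 x0 : V, homog e x0 &
    forall (W : grVect) (g : V -> W) (c : int), linear g ->
      (forall d y, homog d y -> homog (d + c) (g y)) ->
      homog (e + c) (g x) -> g x0 = g x.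
Proof.
have [s [f [us hf ->]]] := homog_span x.
(* The degree [e] joins the support because [s] may miss it; the component is then 0. *)
pose t := undup (e :: s); pose F d := if d \in s then f d else 0.
have hF d : homog d (F d) by rewrite /F; case: ifP => // _; exact: homog0.
exists (F e) => // W g c lg hg.
have -> : \sum_(d <- s) f d = \sum_(d <- t) F d.
  by rewrite sum_pad ?undup_uniq // => d ds; rewrite mem_undup inE ds orbT.
by apply: (homog_coef lg hg); rewrite ?undup_uniq // mem_undup mem_head.
Qed.

Lemma homog_disjoint (V : grVect) (d e : int) (x : V) :
  homog d x -> homog e x -> d != e -> x = 0.
Proof.
move=> hd he de; pose f k := if k == d then x else if k == e then - x else 0.
have := @homog_free V [:: d; e] f; rewrite /= !inE de.
move=> /(_ isT) h; have := h _ _ d; rewrite /f eqxx mem_head; apply=> //.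
  move=> k; case: eqP => [->//|_]; case: eqP => [->|_]; last exact: homog0.
  by rewrite -scaleN1r; apply: homogZ.
by rewrite big_cons big_seq1 eqxx eq_sym (negPf de) eqxx subrr.
Qed.

Lemma homog_sum (V : grVect) d I (r : seq I) (P : pred I) (F : I -> V) :
  (forall i, P i -> homog d (F i)) -> homog d (\sum_(i <- r | P i) F i).
Proof.
move=> h; apply: (big_ind (@homog V d)) => //; first exact: homog0.
exact: homogD.
Qed.

(** * Graded suboperads and induction on free operads *)

(** Membership is boolean so that the subtype inherits its module structure from the library. The
    field [smem_span] says that members have a decomposition into homogeneous members, which makes
    the subspace graded. *)
Record subOperad (O : grOperad) := SubOperad {
  smem : forall n, pred (O n);
  smem0 : forall n, smem (0 : O n);
  smemP : forall n a (x y : O n), smem x -> smem y -> smem (a *: x + y);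
  smem_act : forall n (x : O n) s, smem x -> smem (act x s);
  smem_unit : smem (@opunit O);
  smem_comp : forall n (k : 'I_n -> nat) N (eN : N = (\sum_i k i)%N) (o : O n)
    (a : forall i, O (k i)),
    smem o -> (forall i, smem (a i)) -> smem (comp eN o a);
  smem_span : forall n (x : O n), smem x ->
    gradedSpan (fun d y => homog d y /\ smem y) x }.

Definition spred (O : grOperad) (S : subOperad O) n : {pred O n} := @smem O S n.

Fact spred_submod_closed (O : grOperad) (S : subOperad O) n :
  submod_closed (@spred O S n).
Proof. by split=> [|a x y]; [exact: smem0 | exact: smemP]. Qed.

HB.instance Definition _ (O : grOperad) (S : subOperad O) n :=
  GRing.isSubmodClosed.Build 'F_2 (O n) (@spred O S n) (spred_submod_closed S n).

Record subCar (O : grOperad) (S : subOperad O) n :=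
  SubCar { sop :> O n; _ : sop \in @spred O S n }.

HB.instance Definition _ (O : grOperad) (S : subOperad O) n :=
  [isSub for @sop O S n].
HB.instance Definition _ (O : grOperad) (S : subOperad O) n :=
  [Choice of @subCar O S n by <:].
HB.instance Definition _ (O : grOperad) (S : subOperad O) n :=
  [SubChoice_isSubLmodule of @subCar O S n by <:].

Section SubOperadStructure.
Variables (O : grOperad) (S : subOperad O).
Notation C := (subCar S).

Fact sop_linear n : linear (@sop O S n).
Proof. by []. Qed.

Let shomog n d (x : C n) : Prop := homog d (sop x).

Fact sub_homog0 n d : @shomog n d 0.
Proof. exact: homog0. Qed.

Fact sub_homogP n d a (x y : C n) :
  shomog d x -> shomog d y -> shomog d (a *: x + y).
Proof. exact: homogP. Qed.

Fact sub_homog_span n (x : C n) : gradedSpan (@shomog n) x.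
Proof.
have [s [f [us hf xE]]] := smem_span (valP x).
exists s, (fun d => SubCar (proj2 (hf d) : f d \in @spred O S n)); split=> //.
  by move=> d; case: (hf d).
apply/val_inj; rewrite [LHS]xE.
by rewrite [RHS](lin_sum (@sop_linear n)).
Qed.

Fact sub_homog_free n (s : seq int) (f : int -> C n) :
  uniq s -> (forall d, shomog d (f d)) -> \sum_(d <- s) f d = 0 ->
  forall d, d \in s -> f d = 0.
Proof.
move=> us hf fs d ds; apply/val_inj.
apply: (homog_free (f := fun d => sop (f d)) us hf _ ds).
by rewrite -(lin_sum (@sop_linear n)) fs.
Qed.

Definition subVect n :=
  GrVect (@sub_homog0 n) (@sub_homogP n) (@sub_homog_span n) (@sub_homog_free n).

Definition subAct n (x : subVect n) (s : 'S_n) : subVect n :=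
  SubCar (smem_act s (valP x) : act (sop x) s \in @spred O S n).

Fact sub_act_linear n s : linear ((@subAct n)^~ s).
Proof. by move=> a x y; apply/val_inj; exact: act_linear. Qed.
Fact sub_act_homog n d (x : subVect n) s : homog d x -> homog d (subAct x s).
Proof. exact: act_homog. Qed.
Fact sub_act1 n (x : subVect n) : subAct x 1%g = x.
Proof. by apply/val_inj; exact: act1. Qed.
Fact sub_actM n (x : subVect n) s t : subAct x (t * s)%g = subAct (subAct x s) t.
Proof. by apply/val_inj; exact: actM. Qed.

Definition subMod n : grMod n :=
  GrMod (@sub_act_linear n) (@sub_act_homog n) (@sub_act1 n) (@sub_actM n).

Definition subComp n (k : 'I_n -> nat) N (eN : N = (\sum_i k i)%N)
  (o : subMod n) (a : forall i, subMod (k i)) : subMod N :=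
  SubCar (smem_comp eN (valP o) (fun i => valP (a i)) :
            comp eN (sop o) (fun i => sop (a i)) \in @spred O S N).

Definition subUnit : subMod 1 := SubCar (smem_unit S : opunit \in @spred O S 1).

Lemma sop_dfwith n (k : 'I_n -> nat) (a : forall i, subMod (k i)) i (x : subMod (k i)) :
  (fun j => sop (dfwith a x j)) = dfwith (fun j => sop (a j)) (sop x).
Proof.
apply: functional_extensionality_dep => j; have [ij|ij] := eqVneq i j.
  by case: _ / ij; rewrite !dfwith_in.
by rewrite !dfwith_out.
Qed.

Fact sub_op0 (x : subMod 0) : x = 0.
Proof. by apply/val_inj; exact: op0. Qed.

Fact sub_op1 : subUnit != 0 /\ forall x : subMod 1, exists a : 'F_2, x = a *: subUnit.
Proof.
have [u0 u1] := op1 O; split; first by rewrite -(inj_eq val_inj).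
by move=> x; have [a xE] := u1 (sop x); exists a; apply/val_inj.
Qed.

Fact sub_comp_linearl n k N eN (a : forall i, subMod (k i)) :
  linear (fun o : subMod n => @subComp n k N eN o a).
Proof. by move=> c x y; apply/val_inj; exact: comp_linearl. Qed.

Fact sub_comp_linearr n k N eN (o : subMod n) (a : forall i, subMod (k i)) (i : 'I_n) :
  linear (fun x : subMod (k i) => @subComp n k N eN o (dfwith a x)).
Proof.
by move=> c x y; apply/val_inj; rewrite /= !sop_dfwith; exact: comp_linearr.
Qed.

Fact sub_comp_homog n k N eN (o : subMod n) (a : forall i, subMod (k i))
    (d : int) (e : 'I_n -> int) :
  homog d o -> (forall i, homog (e i) (a i)) ->
  homog (d + \sum_i e i) (@subComp n k N eN o a).
Proof. exact: comp_homog. Qed.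

Fact sub_comp_unitl n (eN : n = (\sum_(i < 1) n)%N) (x : subMod n) :
  @subComp 1 (fun=> n) n eN subUnit (fun=> x) = x.
Proof. by apply/val_inj; exact: comp_unitl. Qed.

Fact sub_comp_unitr n (eN : n = (\sum_(i < n) 1)%N) (x : subMod n) :
  @subComp n (fun=> 1%N) n eN x (fun=> subUnit) = x.
Proof. by apply/val_inj; exact: comp_unitr. Qed.

Fact sub_compA (n : nat) (k : 'I_n -> nat) (N : nat) (eN : N = (\sum_i k i)%N)
    (l : 'I_N -> nat) (M : nat) (eM : M = (\sum_x l x)%N)
    (m : 'I_n -> nat) (em : forall i, m i = (\sum_j l (flat eN (i := i) j))%N)
    (eM' : M = (\sum_i m i)%N)
    (o : subMod n) (a : forall i, subMod (k i)) (b : forall x, subMod (l x)) :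
  subComp eM (subComp eN o a) b =
  subComp eM' o (fun i => subComp (em i) (a i) (fun j => b (flat eN j))).
Proof.
by apply/val_inj; rewrite /= (compA eM em eM').
Qed.

Fact sub_comp_actl (n : nat) (k : 'I_n -> nat) (N : nat) (s : 'S_n)
    (eN : N = (\sum_i k i)%N) (eN' : N = (\sum_i k ((s^-1)%g i))%N)
    (o : subMod n) (a : forall i, subMod (k i)) :
  subComp eN (act o s) a =
  act (subComp eN' o (fun i => a ((s^-1)%g i))) (blockPerm eN eN').
Proof. by apply/val_inj; exact: (comp_actl eN eN' (sop o) (fun i => sop (a i))). Qed.

Fact sub_comp_actr (n : nat) (k : 'I_n -> nat) (N : nat)
    (eN : N = (\sum_i k i)%N) (t : forall i, 'S_(k i))
    (o : subMod n) (a : forall i, subMod (k i)) :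
  subComp eN o (fun i => act (a i) (t i)) = act (subComp eN o a) (sumPerm eN t).
Proof. by apply/val_inj; exact: comp_actr. Qed.

Definition subGrOperad : grOperad :=
  @GrOperad subMod subComp subUnit sub_op0 sub_op1 (opunit_homog O)
    sub_comp_linearl sub_comp_linearr sub_comp_homog sub_comp_unitl
    sub_comp_unitr sub_compA sub_comp_actl sub_comp_actr.

Lemma isGrOperadMap_sop (P : grOperad) (f : forall n, P n -> subGrOperad n) :
  isGrOperadMap f -> isGrOperadMap (fun n x => sop (f n x)).
Proof.
move=> [fM f1 fc]; split=> [n||n k N eN o a]; last by rewrite fc.
  have [fl fh fa] := fM n; split=> [a x y|d x hx|x s]; first by rewrite fl.
    exact: fh.
  by rewrite fa.
by rewrite f1.
Qed.
End SubOperadStructure.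

(* The inclusion of a suboperad containing the generators has a section, since
   the composite of the induced map with the inclusion is the identity. *)
Lemma free_operad_ind (O : grOperad) (e : nat -> O 2%N) (G : nat -> nat -> O 4%N)
    (S : subOperad O) :
  isFreeOn e G ->
  (forall i, smem S (e i)) -> (forall m n, (1 <= m <= n)%N -> smem S (G m n)) ->
  forall n (x : O n), smem S x.
Proof.
move=> [[he hG] Ofree] Se SG n x.
pose e' i : subGrOperad S 2 := SubCar (Se i : e i \in @spred O S 2).
(* Membership of [G m k] is known only for [1 <= m <= k]; elsewhere [insubd] may return the default
   0, and those values do not matter. *)
pose G' m k : subGrOperad S 4 := insubd (0 : subCar S 4) (G m k).
have G'E m k : (1 <= m <= k)%N -> sop (G' m k) = G m k.
  by move=> mk; rewrite [LHS]val_insubd ifT //; exact: SG.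
have [|[f [fM fe fG]] _] := Ofree (subGrOperad S) e' G'.
  split=> [i|m k mk]; first exact: he.
  by rewrite /homog /= G'E //; exact: hG.
have [_ Ouniq] := Ofree O e G (conj he hG).
have <- : sop (f n x) = x; last exact: (valP (f n x)).
apply: (Ouniq (fun n x => sop (f n x)) (fun n x => x)).
  split=> [|i|m k mk]; first exact: isGrOperadMap_sop.
    by rewrite fe.
  by rewrite fG // G'E.
by split=> //; split.
Qed.

(** * Relations preserved by the formulas for [alpha] and [dG] *)

Section Parametricity.
Variables (O P : grOperad) (R2 : O 2 -> P 2 -> Prop) (R4 : O 4 -> P 4 -> Prop).
Hypotheses (R2_0 : R2 0 0) (R2_act : forall x y s, R2 x y -> R2 (act x s) (act y s))
  (R4_0 : R4 0 0)
  (R4D : forall x y x' y', R4 x y -> R4 x' y' -> R4 (x + x') (y + y'))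
  (R4Z : forall c x y, R4 x y -> R4 (c *: x) (c *: y))
  (R4_act : forall x y s, R4 x y -> R4 (act x s) (act y s))
  (R4_comp2 : forall o o' x x' y y', R2 o o' -> R2 x x' -> R2 y y' ->
     R4 (comp2 o x y) (comp2 o' x' y')).
Variables (e : nat -> O 2) (e' : nat -> P 2).
Hypothesis Re : forall i, R2 (e i) (e' i).

Lemma ez_param x : R2 (ez e x) (ez e' x).
Proof. by case: x. Qed.

Lemma uelt_param m n x : R4 (uelt e m n x) (uelt e' m n x).
Proof.
have Rz := ez_param x; rewrite /uelt; case: n => [[|n]|n] //.
  by apply: R4_comp2 => //; apply: R2_act.
have Rsum I (r : seq I) (Q : pred I) F F' : (forall i, R4 (F i) (F' i)) ->
    R4 (\sum_(i <- r | Q i) F i) (\sum_(i <- r | Q i) F' i).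
  by move=> h; apply: (big_ind2 R4).
do 2![apply: (Rsum) => ?]; apply/R4Z/R4D; apply/R4Z/R4_comp2 => //; exact: R2_act.
Qed.

Lemma alpha_param n p : R4 (alpha e n p) (alpha e' n p).
Proof.
apply: R4D; apply: (big_ind2 R4) => // i _; last apply: R4_act; exact: uelt_param.
Qed.

(** The formula uses only sums, scalars, permutations and [comp2]. Every [Gz] in [dG G e m n.+1] has
    lower index [n], also when [n.+1 = m], so a hypothesis on that column suffices. *)
Lemma dG_param (G : nat -> nat -> O 4) (G' : nat -> nat -> P 4) m n :
  (forall a, R4 (Gz G a n) (Gz G' a n)) -> R4 (dG G e m n.+1) (dG G' e' m n.+1).
Proof.
move=> RG; rewrite /dG subSS subn0.
have Rh : R4 (if n.+1 == m then act (Gz G (m - 1) (m - 1)) s3214 else Gz G m n)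
             (if n.+1 == m then act (Gz G' (m - 1) (m - 1)) s3214 else Gz G' m n).
  case: eqP => [<-|_] //; rewrite subSS subn0; exact: R4_act.
apply: R4D (R4_act _ (alpha_param _ _)); apply: R4D (alpha_param _ _).
by apply: R4D; apply: R4D => //; apply: R4_act.
Qed.
End Parametricity.

(** * Degrees of [alpha] and [dG] *)

Section Homogeneity.
Variables (O : grOperad) (e : nat -> O 2).
Hypothesis he : forall i : nat, homog (- i%:Z) (e i).

Lemma comp2_homog a b c (o x y : O 2) :
  homog a o -> homog b x -> homog c y -> homog (a + (b + c)) (comp2 o x y).
Proof.
move=> ho hx hy.
have -> : b + c = \sum_(i < 2) if i == ord0 then b else c.
  by rewrite !big_ord_recl big_ord0 addr0.
by apply: comp_homog => // i; case: ifP.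
Qed.

Lemma ez_homog x : homog (- x) (ez e x).
Proof. by case: x => [a|a]; [exact: he | exact: homog0]. Qed.

Lemma uelt_homog m n x : homog (- n - x) (uelt e m n x).
Proof.
have ht : homog (- x) (act (ez e x) (s21 ^+ m.-1)%g).
  by apply: act_homog; exact: ez_homog.
rewrite /uelt; case: n => [[|n]|n]; last exact: homog0.
  by rewrite oppr0 add0r -[- x]addr0 -[X in homog (_ + X) _]addr0;
     apply: comp2_homog => //; exact: (he 0).
set K := (2 ^ _)%N; apply: homog_sum => i _; apply: homog_sum => d /andP[id dn].
(* The bounds on [K * d] make both truncated subtractions exact, so the two indices add up to
   [n.+1]. *)
have -> : - n.+1%:Z - x = - x + (- (K * d - i)%N%:Z - (n.+1 + i - K * d)%N%:Z).
  rewrite -!subzn // PoszD [LHS]addrC; congr (_ + _).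
  by rewrite -opprD [in RHS]addrC addrA subrK addrK.
by apply/homogZ/homogD; apply/homogZ/comp2_homog => //; do ?apply: act_homog; exact: he.
Qed.

Lemma alpha_homog n p : homog (- n) (alpha e n p).
Proof.
have deg q r : - n = - (q + r) - (n - q - r).
  by rewrite -[RHS]opprD -(addrA n) -opprD [_ + (n - _)]addrC subrK.
apply: homogD; apply: homog_sum => s _; last apply: act_homog.
  by rewrite [X in homog X _](deg s%:Z p); exact: uelt_homog.
rewrite [X in homog X _](deg s%:Z (p + 1)) [s%:Z + (p + 1)]addrA.
rewrite [- (p + 1)]opprD [n - s%:Z + _]addrA.
exact: uelt_homog.
Qed.

Lemma dG_homog (G : nat -> nat -> O 4) m n :
  (forall a, homog (- n%:Z) (Gz G a n)) -> homog (- n%:Z) (dG G e m n.+1).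
Proof.
move=> hG; rewrite /dG subSS subn0.
have -> : n.+1%:Z - 1 = n by rewrite -addn1 PoszD addrK.
have hh : homog (- n%:Z)
    (if n.+1 == m then act (Gz G (m - 1) (m - 1)) s3214 else Gz G m n).
  case: eqP => [<-|_] //; rewrite subSS subn0; exact: act_homog.
apply: homogD (act_homog _ (alpha_homog _ _)).
apply: homogD (alpha_homog _ _).
by apply: homogD; apply: homogD => //; apply: act_homog.
Qed.
End Homogeneity.

(** * Images of the formulas under maps of graded operads *)

Section OperadMaps.
Variables (O P : grOperad) (f : forall n, O n -> P n).
Hypothesis fM : isGrOperadMap f.

Lemma operadMap_linear n : linear (@f n).
Proof. by have [/(_ n)[]] := fM. Qed.

Lemma operadMap_act n (x : O n) s : f (act x s) = act (f x) s.
Proof. by have [/(_ n)[]] := fM. Qed.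

Lemma operadMap_comp2 (o x y : O 2) : f (comp2 o x y) = comp2 (f o) (f x) (f y).
Proof.
have [_ _ fc] := fM; rewrite /comp2 fc; congr comp.
by apply: functional_extensionality_dep => i; case: ifP.
Qed.

Variables (e : nat -> O 2) (e' : nat -> P 2).
Hypothesis fe : forall i, f (e i) = e' i.

Lemma operadMap_ez x : f (ez e x) = ez e' x.
Proof.
apply: (ez_param (R2 := fun x y => f x = y)) => //.
exact: lin0 (@operadMap_linear 2%N).
Qed.

(** This is [dG_param] for the graph of [f]. *)
Lemma operadMap_dG (G : nat -> nat -> O 4) (G' : nat -> nat -> P 4) m n :
  (forall a, f (Gz G a n) = Gz G' a n) -> f (dG G e m n.+1) = dG G' e' m n.+1.
Proof.
have fl n' := @operadMap_linear n'.
apply: (dG_param (R2 := fun x y => f x = y) (R4 := fun x y => f x = y)) => //.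
- exact: lin0 (fl 2%N).
- by move=> x y s <-; rewrite operadMap_act.
- exact: lin0 (fl 4%N).
- by move=> x y x' y' <- <-; rewrite (linD (fl 4%N)).
- by move=> c x y <-; rewrite (linZ (fl 4%N)).
- by move=> x y s <-; rewrite operadMap_act.
- by move=> o o' x x' y y' <- <- <-; rewrite operadMap_comp2.
Qed.
End OperadMaps.

(** * Elements on which an operad map commutes with the differentials *)

Section Differentials.
Variable O : dgOperad.

Lemma homog_unit_eq0 (x : O 1%N) d : d != 0 -> homog d x -> x = 0.
Proof.
have [_ /(_ x)[c ->]] := op1 O => d0 hd; apply: homog_disjoint hd _ d0.
exact/homogZ/opunit_homog.
Qed.

(** Arity one is F_2 in degree 0, and the differential of the unit has degree 1. *)
Lemma odiff_unit : odiff (@opunit O) = 0.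
Proof. by apply: (@homog_unit_eq0 _ (0 + 1)) => //; apply/odiff_homog/opunit_homog. Qed.
End Differentials.

Section Commutator.
Variables (O P : dgOperad) (f : forall n, O n -> P n).
Hypothesis fM : isGrOperadMap f.

Definition commutes n (x : O n) : bool := f (odiff x) == odiff (f x).

Lemma commutesP n a (x y : O n) : commutes x -> commutes y -> commutes (a *: x + y).
Proof.
move=> /eqP hx /eqP hy; have fl p := @operadMap_linear _ _ _ fM p.
by rewrite /commutes odiff_linear !fl odiff_linear hx hy.
Qed.

Lemma commutes0 n : commutes (0 : O n).
Proof.
by rewrite /commutes (lin0 (@odiff_linear O n)) (lin0 (@operadMap_linear _ _ _ fM n))
           (lin0 (@odiff_linear P n)).
Qed.

Lemma commutes_act n (x : O n) s : commutes x -> commutes (act x s).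
Proof.
by move=> /eqP hx; rewrite /commutes odiff_act !(operadMap_act fM) odiff_act hx.
Qed.

Lemma commutes_unit : commutes (@opunit O).
Proof.
have [_ fu _] := fM.
by rewrite /commutes fu !odiff_unit (lin0 (@operadMap_linear _ _ _ fM 1%N)).
Qed.

Lemma commutes_comp n (k : 'I_n -> nat) N (eN : N = (\sum_i k i)%N) (o : O n)
    (a : forall i, O (k i)) :
  commutes o -> (forall i, commutes (a i)) -> commutes (comp eN o a).
Proof.
move=> /eqP ho ha; have [_ _ fc] := fM; have fl p := @operadMap_linear _ _ _ fM p.
apply/eqP; rewrite fc !odiff_comp (linD (fl _)) (lin_sum (fl _)) fc ho.
congr (_ + _); apply: eq_bigr => i _; rewrite fc; congr comp.
apply: functional_extensionality_dep => j; have [ij|ij] := eqVneq i j.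
  by case: _ / ij; rewrite !dfwith_in; exact/eqP/ha.
by rewrite !dfwith_out.
Qed.

Lemma commutes_comp2 (o x y : O 2) :
  commutes o -> commutes x -> commutes y -> commutes (comp2 o x y).
Proof. by move=> ho hx hy; apply: commutes_comp => // i; case: ifP. Qed.

(** The commutator of [f] with the differentials is linear and homogeneous of degree 1, so its
    kernel contains the homogeneous components of its elements. *)
Lemma commutes_span n (x : O n) : commutes x ->
  gradedSpan (fun d y => homog d y /\ commutes y) x.
Proof.
move=> /eqP cx; have [s [h [us hh xE]]] := homog_span x.
have fl p := @operadMap_linear _ _ _ fM p; have [fh _] := fM.
pose g (y : O n) : P n := f (odiff y) - odiff (f y).
have gl : linear g.
  move=> a y z; rewrite /g odiff_linear !fl odiff_linear.
  by rewrite scalerBr opprD addrACA.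
have gh d y : homog d y -> homog (d + 1) (g y).
  move=> hy; have [_ fhn _] := fh n; apply: homogB; first exact/fhn/odiff_homog.
  exact/odiff_homog/fhn.
have gx : g x = 0 by rewrite /g cx subrr.
(* The property is required in every degree but known only on [s], hence the truncation by 0. *)
exists s, (fun d => if d \in s then h d else 0); split=> // [d|].
  case: ifP => ds; last by split; [exact: homog0 | exact: commutes0].
  split=> //; rewrite /commutes -subr_eq0 -/(g _) (homog_coef gl gh us hh ds) -xE gx //.
  exact: homog0.
by rewrite sum_pad.
Qed.

Definition commutesSubOperad : subOperad O :=
  SubOperad commutes0 commutesP commutes_act commutes_unit commutes_comp commutes_span.
End Commutator.

(** * The group of order two and invariants in projective modules *)

Lemma s21K : (s21 * s21 = 1)%g.
Proof. exact: tperm2. Qed.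

Lemma actK21 (M : grMod 2) (x : M) : act (act x s21) s21 = x.
Proof. by rewrite -actM s21K act1. Qed.

Lemma s21_neq1 : s21 != 1%g.
Proof.
apply/eqP => /permP /(_ (i2 0)); rewrite perm1 tpermL => /(congr1 val).
by rewrite /= !inordK.
Qed.

Lemma S2_cases (s : 'S_2) : s = 1%g \/ s = s21.
Proof.
have /setP/(_ s) : [set 1%g; s21] = [set: 'S_2].
  by apply/eqP; rewrite eqEcard subsetT cardsT card_Sn cards2 eq_sym s21_neq1.
by rewrite !inE => /orP[] /eqP; [left | right].
Qed.

Lemma sum_S2 (V : zmodType) (F : 'S_2 -> V) : \sum_s F s = F 1%g + F s21.
Proof.
rewrite (bigD1 1%g) //= (bigD1 s21) ?s21_neq1 //= big1 ?addr0 // => s.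
by case: (S2_cases s) => ->; rewrite eqxx ?andbF.
Qed.

Section CoinducedModule.
Variables (n : nat) (M : grMod n).

Let coCar : lmodType 'F_2 := {ffun 'S_n -> M}.
(** With the order of factors in [actM], this translation makes the map sending [F] to the sum of
    the [act (F s) s] equivariant. *)
Let coAct (F : coCar) (t : 'S_n) : coCar := [ffun v => F (t^-1 * v)%g].

Fact co_act_linear t : linear (coAct^~ t).
Proof. by move=> a x y; apply/ffunP => v; rewrite !ffunE. Qed.
Fact co_act1 x : coAct x 1%g = x.
Proof. by apply/ffunP => v; rewrite ffunE invg1 mul1g. Qed.
Fact co_actM x s t : coAct x (t * s)%g = coAct (coAct x s) t.
Proof. by apply/ffunP => v; rewrite !ffunE invMg mulgA. Qed.

Definition coinduced : symMod n := SymMod co_act_linear co_act1 co_actM.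

(* The sum map from the coinduced module onto M splits when M is projective;
   the splitting sends an invariant element to a constant function. *)
Lemma projective_invariant (x : M) :
  projective M -> (forall s, act x s = x) -> exists y, x = \sum_s act y s.
Proof.
move=> Mproj xinv.
pose p (F : coinduced) : forgetGr M := \sum_s act (F s : M) s.
have pM : isSymMap p.
  split=> [a F F'|F t].
    rewrite /p scaler_sumr -big_split; apply: eq_bigr => s _.
    by rewrite !ffunE act_linear.
  rewrite /p /= (lin_sum (@act_linear _ M t)) (reindex_inj (mulgI t)).
  by apply: eq_bigr => s _; rewrite ffunE mulKg actM.
have pS : surjective p.
  move=> y; exists [ffun s => if s == 1%g then y else 0].
  rewrite /p (bigD1 1%g) //= ffunE eqxx act1 big1 ?addr0 // => s /negPf s1.
  by rewrite ffunE s1 (lin0 (@act_linear _ M s)).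
have [g [_ gact] pg] := Mproj _ _ p id pM pS (conj (fun _ _ _ => erefl) (fun _ _ => erefl)).
exists (g x 1%g); rewrite -[LHS](pg x) /p; apply: eq_bigr => s _; congr act.
have /(congr1 (fun F : coCar => F s)) := gact x s.
by rewrite /= xinv ffunE mulVg.
Qed.
End CoinducedModule.

Lemma projective_invariant2 (M : grMod 2) (x : M) :
  projective M -> act x s21 = x -> exists w, x = w + act w s21.
Proof.
move=> Mproj xs; have [s|w ->] := projective_invariant (x := x) Mproj.
  by have [->|->] := S2_cases s; rewrite ?act1.
by exists w; rewrite sum_S2 act1.
Qed.

(** * Arity two of a free operad *)

Section ArityTwo.
Variable O : grOperad.

Lemma comp_eq0 n (k : 'I_n -> nat) N (eN : N = (\sum_i k i)%N) (o : O n)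
  (a : forall i, O (k i)) i : a i = 0 -> comp eN o a = 0.
Proof.
move=> ai0; rewrite -(lin0 (comp_linearr eN o a (i := i))); congr comp.
apply: functional_extensionality_dep => j; have [ij|ij] := eqVneq i j.
  by case: _ / ij; rewrite dfwith_in.
by rewrite dfwith_out.
Qed.

(** Since O(0) = 0, nonzero inputs have positive arity, so [n <= 2]. Since O(1) = F_2, for [n = 1]
    the composite is a multiple of its only input, and for [n = 2] nonzero inputs are all the unit
    and the composite is [o]. Thus arity two receives nothing new from composition. *)
Lemma comp_into_arity2 (Q : forall n, O n -> Prop) n (k : 'I_n -> nat)
    (eN : 2%N = (\sum_i k i)%N) (o : O n) (a : forall i, O (k i)) :
  Q 2%N 0 -> (forall c (x : O 2%N), Q 2%N x -> Q 2%N (c *: x)) ->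
  Q n o -> (forall i, Q _ (a i)) -> Q 2%N (comp eN o a).
Proof.
move=> Q0 QZ Qo Qa; have [/existsP[i /eqP ai0]|] := boolP [exists i, a i == 0].
  by rewrite (comp_eq0 eN o ai0).
move/existsPn => a0.
have k_gt0 i : (0 < k i)%N.
  move: (a i) (a0 i); case: (k i) => // x; by rewrite (op0 x) eqxx.
have n_le2 : (n <= 2)%N.
  by rewrite eN -[X in (X <= _)%N]card_ord -sum1_card; apply: leq_sum.
case: n k eN o a Qo Qa a0 k_gt0 n_le2 => [|[|[|//]]] k eN o a Qo Qa a0 k_gt0 _.
- by rewrite (op0 o) (lin0 (comp_linearl eN a)).
- have [c ->] := proj2 (op1 O) o; rewrite (linZ (comp_linearl eN a)).
  have kE : k = fun=> 2%N by apply: funext => i; rewrite (ord1 i) [RHS]eN big_ord1.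
  subst k; apply: QZ.
  have -> : a = fun=> a ord0 by apply: functional_extensionality_dep => i; rewrite (ord1 i).
  by rewrite comp_unitl.
- have kE : k = fun=> 1%N.
    apply: funext => i; apply/eqP; rewrite eqn_leq k_gt0 andbT -ltnS.
    rewrite [X in (_ < X)%N]eN (bigD1 i) //= -[X in (X < _)%N]addn0 ltn_add2l.
    have [j ji] : exists j, j != i.
      by exists (rev_ord i); case: i => [[|[|]]].
    by rewrite (bigD1 j) //= addn_gt0 k_gt0.
  subst k; have -> : a = fun=> opunit.
    apply: functional_extensionality_dep => i; have [c aE] := proj2 (op1 O) (a i).
    have [c0|c1] := F2_cases c; last by rewrite aE c1 scale1r.
    by have := a0 i; rewrite aE c0 scale0r eqxx.
  by rewrite comp_unitr.
Qed.

Section Span.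
Variable e : nat -> O 2%N.
Hypothesis he : forall i : nat, homog (- i%:Z) (e i).

(** The degree [d] part of the submodule generated by the [e i]; it vanishes for [d > 0] because
    [ez] is 0 at negative indices. *)
Definition orbitSpan (d : int) (x : O 2%N) : Prop :=
  exists a b, x = a *: ez e (- d) + b *: act (ez e (- d)) s21.

Lemma orbitSpan0 d : orbitSpan d 0.
Proof. by exists 0, 0; rewrite !scale0r addr0. Qed.

Lemma orbitSpanP d c x y : orbitSpan d x -> orbitSpan d y -> orbitSpan d (c *: x + y).
Proof.
move=> [a [b ->]] [a' [b' ->]]; exists (c * a + a'), (c * b + b').
by rewrite scalerDr !scalerA addrACA -!scalerDl.
Qed.

Lemma orbitSpan_act d x s : orbitSpan d x -> orbitSpan d (act x s).
Proof.
move=> [a [b ->]]; have [->|->] := S2_cases s; first by rewrite act1; exists a, b.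
by exists b, a; rewrite act_linear (linZ (@act_linear _ _ s21)) actK21 addrC.
Qed.

Lemma orbitSpan_homog d x : orbitSpan d x -> homog d x.
Proof.
move=> [a [b ->]]; have := ez_homog he (- d); rewrite opprK => h.
by apply: homogP => //; apply/homogZ/act_homog.
Qed.

(** A condition on arity two alone still gives a suboperad, by [comp_into_arity2]; the generators
    [G] in arity four then satisfy it trivially. *)
Definition spanMem n : O n -> Prop :=
  match n with 2%N => gradedSpan orbitSpan | _ => fun=> True end.

Lemma gradedSpan_act x s : gradedSpan orbitSpan x -> gradedSpan orbitSpan (act x s).
Proof.
move=> [t [f [ut hf ->]]]; exists t, (fun d => act (f d) s); split=> // [d|].
  exact: orbitSpan_act.
exact: (lin_sum (@act_linear _ _ s)).
Qed.

Lemma spanMemP n a (x y : O n) : spanMem x -> spanMem y -> spanMem (a *: x + y).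
Proof.
by case: n x y => [|[|[|n]]] x y //; apply: gradedSpanP;
  [exact: orbitSpan0 | exact: orbitSpanP].
Qed.

Lemma spanMem0 n : spanMem (0 : O n).
Proof. by case: n => [|[|[|n]]] //; apply: (@gradedSpan1 _ _ orbitSpan0 0);
  exact: orbitSpan0. Qed.

Lemma spanMem_act n (x : O n) s : spanMem x -> spanMem (act x s).
Proof. by case: n x s => [|[|[|n]]] x s //; exact: gradedSpan_act. Qed.

Lemma spanMem_comp n (k : 'I_n -> nat) N (eN : N = (\sum_i k i)%N) (o : O n)
    (a : forall i, O (k i)) :
  spanMem o -> (forall i, spanMem (a i)) -> spanMem (comp eN o a).
Proof.
case: N eN => [|[|[|N]]] eN // ho ha.
apply: (@comp_into_arity2 spanMem) => //; first exact: spanMem0.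
by move=> c x hx; rewrite -[c *: x]addr0; apply: spanMemP => //; exact: spanMem0.
Qed.

Lemma spanMem_span n (x : O n) : spanMem x ->
  gradedSpan (fun d y => homog d y /\ `[< spanMem y >]) x.
Proof.
case: n x => [|[|[|n]]] x hx; have [s [f [us hf xE]]] := homog_span x;
  try by exists s, f; split=> // d; split=> //; exact/asboolP.
move: hx => [t [g [ut hg xE']]]; exists t, g; split=> // d.
split; first exact: orbitSpan_homog.
apply/asboolP; exact: (gradedSpan1 orbitSpan0 (hg d)).
Qed.

Definition spanSubOperad : subOperad O.
Proof.
refine (@SubOperad O (fun n x => `[< spanMem x >]) _ _ _ _ _ _).
- by move=> n; apply/asboolP; exact: spanMem0.
- by move=> n a x y /asboolP hx /asboolP hy; apply/asboolP; exact: spanMemP.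
- by move=> n x s /asboolP hx; apply/asboolP; exact: spanMem_act.
- exact/asboolP.
- move=> n k N eN o a /asboolP ho ha; apply/asboolP; apply: spanMem_comp => // i.
  exact/asboolP.
- by move=> n x /asboolP; exact: spanMem_span.
Defined.

End Span.

Lemma free_arity2_span (e : nat -> O 2%N) (G : nat -> nat -> O 4%N) (x : O 2%N) :
  isFreeOn e G -> gradedSpan (orbitSpan e) x.
Proof.
move=> free; have [[he _] _] := free.
suff: smem (spanSubOperad he) x by move/asboolP.
apply: (free_operad_ind (S := spanSubOperad he) free) => [i|m n _]; last exact/asboolP.
apply/asboolP/(@gradedSpan1 _ _ (orbitSpan0 e) (- i%:Z)).
by exists 1, 0; rewrite scale1r scale0r addr0 opprK.
Qed.
End ArityTwo.

(** * Cycles in arity two *)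

Lemma ez_pred (O : grOperad) (e : nat -> O 2%N) (i : nat) : ez e (i.+1%:Z - 1) = e i.
Proof. by have -> : i.+1%:Z - 1 = i by rewrite -addn1 PoszD addrK. Qed.

Section Resolution.
Variables (O : dgOperad) (e : nat -> O 2%N).
Hypothesis de : forall i : nat,
  odiff (e i) = ez e (i%:Z - 1) + act (ez e (i%:Z - 1)) s21.

Lemma odiff_e0 : odiff (e 0) = 0.
Proof. by rewrite de /= (lin0 (@act_linear _ _ s21)) addr0. Qed.

Lemma odiff_eS i : odiff (e i.+1) = e i + act (e i) s21.
Proof. by rewrite de ez_pred. Qed.

(** Homogeneous components of a cycle are cycles. In degree 0, [a *: e 0 + b *: act (e 0) s21]
    differs from [(a + b) *: e 0] by the boundary of [b *: e 1]. In degree [- i.+1] the differential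
    is [a + b] times the norm of [e i]; this norm is nonzero, so [a = b] and the component bounds
    [b *: e i.+2]. *)
Lemma arity2_cycle (x : O 2%N) :
  (forall i, homog (- i%:Z) (e i)) -> (forall i, e i + act (e i) s21 <> 0) ->
  gradedSpan (orbitSpan e) x -> odiff x = 0 ->
  exists c z, x = c *: e 0 + odiff z.
Proof.
move=> he e_free [s [f [us hf ->]]] dx.
have hom d : homog d (f d) := orbitSpan_homog he (hf d).
have df d : d \in s -> odiff (f d) = 0.
  move=> ds; rewrite (homog_coef (@odiff_linear O 2) (@odiff_homog O 2) us hom ds) dx //.
  exact: homog0.
pose Q x := exists c z, x = c *: e 0 + odiff z.
have dl := @odiff_linear O 2.
rewrite big_seq; apply: (big_ind Q).
- by exists 0, 0; rewrite scale0r (lin0 dl) addr0.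
- move=> _ _ [c [z ->]] [c' [z' ->]]; exists (c + c'), (z + z').
  by rewrite scalerDl (linD dl) addrACA.
move=> d /df; have [a [b]] := hf d; case: (- d) => [[|i]|i] /= ->.
- move=> _; exists (a + b), (b *: e 1); rewrite (linZ dl) odiff_eS scalerDl scalerDr.
  by rewrite -addrA; congr (_ + _); rewrite addrA addrr_F2 add0r.
- rewrite dl (linZ dl) odiff_act odiff_eS (linD (@act_linear _ _ s21)) actK21.
  rewrite [act _ _ + _]addrC -scalerDl.
  have [ab0|ab1] := F2_cases (a + b); last first.
    by rewrite ab1 scale1r => /e_free.
  have -> : a = b by rewrite -[a]addr0 -(addrr_F2 (b : ('F_2)^o)) addrA ab0 add0r.
  by move=> _; exists 0, (b *: e i.+2); rewrite scale0r add0r (linZ dl) odiff_eS scalerDr.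
- move=> _; exists 0, 0; rewrite (lin0 (@act_linear _ _ s21)) !scaler0 scale0r.
  by rewrite (lin0 dl).
Qed.
End Resolution.

(** * Lifting the generators to an E_infinity-operad *)

Section Einfty.
Variables (E : dgOperad) (phi : forall n, E n -> Com n).
Hypotheses (phiM : isDgOperadMap phi) (phiS : fibration phi)
  (phiW : weakEquivalence phi).

Let dl n := @odiff_linear E n.
Let phil n := @operadMap_linear _ _ _ (proj1 phiM) n.

Lemma augmentation_act n (x : E n) s : phi (act x s) = phi x.
Proof. by rewrite (operadMap_act (proj1 phiM)). Qed.

Lemma augmentation_odiff n (x : E n) : phi (odiff x) = 0.
Proof. by have [_ ->] := phiM. Qed.

Lemma augmentation_homog n d (x : E n) : d != 0 -> homog d x -> phi x = 0.
Proof.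
have [[/(_ n)[_ ph _] _ _] _] := phiM => d0 /ph; case=> // dE.
by rewrite dE eqxx in d0.
Qed.

(** The augmentation is injective on homology, so [x] bounds; the component of degree [d - 1] of any
    primitive is again a primitive. *)
Lemma exists_primitive n d (x : E n) : homog d x -> odiff x = 0 -> phi x = 0 ->
  exists2 z, homog (d - 1) z & odiff z = x.
Proof.
move=> hx dx px; have [|z xE] := proj1 (phiW n) x dx; first by exists 0; rewrite px.
have [z0 hz0 z0E] := homog_component z (d - 1); exists z0 => //.
have odz : odiff z = x by [].
rewrite -odz; apply: (z0E _ (@odiff E n) 1 (@dl n) (@odiff_homog E n)).
by rewrite subrK odz.
Qed.

(** Choice makes primitives a total function, so that generators can be defined by plain recursion
    and the cycle conditions checked afterwards. *)
Lemma primitive n : exists prim : int -> E n -> E n, forall d x,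
  homog d x -> odiff x = 0 -> phi x = 0 ->
  homog (d - 1) (prim d x) /\ odiff (prim d x) = x.
Proof.
pose P (q : int * E n) z := homog q.1 q.2 -> odiff q.2 = 0 -> phi q.2 = 0 ->
  homog (q.1 - 1) z /\ odiff z = q.2.
have [|prim primP] := @choice _ _ P; last by exists (fun d x => prim (d, x)) => d x;
  exact: (primP (d, x)).
move=> [d x]; have [[hx [dx px]]|no] := pselect (homog d x /\ odiff x = 0 /\ phi x = 0).
  by have [z hz zE] := exists_primitive hx dx px; exists z.
by exists 0 => hx dx px; case: no.
Qed.

(** Surjectivity on homology gives a cycle over 1, since boundaries in [Com] vanish. Its degree 0
    component keeps both the differential and the augmentation. *)
Lemma exists_unit_cycle : exists x : E 2%N,
  [/\ homog 0 x, odiff x = 0 & phi x = comMk 2 1].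
Proof.
have [x [z [dx xE]]] := proj2 (phiW 2) (comMk 2 1) erefl.
have px : phi x = comMk 2 1 by rewrite xE addr0.
have [x0 hx0 x0E] := homog_component x 0; exists x0; split=> //.
  rewrite (x0E _ (@odiff E 2) 1 (@dl 2) (@odiff_homog E 2)) //.
  by rewrite [odiff x]dx; exact: homog0.
rewrite (x0E _ (@phi 2) 0 (@phil 2)) // => [d y|]; last by left.
by rewrite addr0; have [[/(_ 2)[_ ph _] _ _] _] := phiM; exact: ph.
Qed.

(** The norm of [e i] has zero augmentation because [Com] carries the trivial action in
    characteristic 2. It is a cycle because the differential of [e i] is itself 0 or a norm, and the
    norm of a norm is 0. *)
Lemma exists_resolution_gens : exists e : nat -> E 2%N,
  [/\ forall i, homog (- i%:Z) (e i), phi (e 0) = comMk 2 1 &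
      forall i : nat, odiff (e i) = ez e (i%:Z - 1) + act (ez e (i%:Z - 1)) s21].
Proof.
have [prim primP] := primitive 2; have [e0 [he0 de0 pe0]] := exists_unit_cycle.
pose e := fix e i := if i is j.+1 then prim (- j%:Z) (e j + act (e j) s21) else e0.
have eP i : homog (- i%:Z) (e i) /\ odiff (e i + act (e i) s21) = 0.
  have norm_cycle (x : E 2%N) : odiff x = 0 -> odiff (x + act x s21) = 0.
    by move=> dx; rewrite (linD (@dl 2)) odiff_act dx (lin0 (@act_linear _ _ s21)) addr0.
  elim: i => [|i [hi di]]; first by split=> //; exact: norm_cycle.
  have [||] := primP (- i%:Z) (e i + act (e i) s21) _ di.
  - by apply: homogD => //; exact: act_homog.
  - by rewrite (linD (@phil 2)) augmentation_act addrr_F2.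
  rewrite -/(e i.+1) -opprD -PoszD addn1 => hS dS; split=> //.
  rewrite (linD (@dl 2)) odiff_act dS (linD (@act_linear _ _ s21)) actK21.
  by rewrite [X in _ + X]addrC addrr_F2.
exists e; split=> // [i|[|i]]; first by case: (eP i).
  by rewrite /= de0 (lin0 (@act_linear _ _ s21)) addr0.
rewrite ez_pred; have [hi di] := eP i.
have [||] := primP (- i%:Z) (e i + act (e i) s21) _ di => //.
  by apply: homogD => //; exact: act_homog.
by rewrite (linD (@phil 2)) augmentation_act addrr_F2.
Qed.

Lemma comMk1_neq0 : comMk 2 1 <> 0 :> comCar 2.
Proof. by move=> /(congr1 (@comVal 2)); rewrite comValK comVal0 => /eqP;
  rewrite oner_eq0. Qed.

Section Generators.
Variable e : nat -> E 2%N.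
Hypotheses (he : forall i, homog (- i%:Z) (e i)) (pe : phi (e 0) = comMk 2 1)
  (de : forall i : nat, odiff (e i) = ez e (i%:Z - 1) + act (ez e (i%:Z - 1)) s21).

(* Descent on i: e_i + dy invariant is a norm w + w.s, and applying d shows
   that e_(i-1) + dw is invariant; at i = 0 this contradicts phi (e 0) = 1. *)
Lemma not_invariant i y : projective (E 2%N) ->
  act (e i + odiff y) s21 <> e i + odiff y.
Proof.
move=> Eproj; elim: i y => [|i IH] y /(projective_invariant2 Eproj)[w wE].
  have /(congr1 (@phi 2)) := wE; rewrite !(linD (@phil 2)) augmentation_act addrr_F2.
  by rewrite pe augmentation_odiff addr0; exact: comMk1_neq0.
have /(congr1 (@odiff E 2)) := wE; rewrite !(linD (@dl 2)) odiffK addr0.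
rewrite odiff_eS // odiff_act => H; apply: (IH w).
rewrite (linD (@act_linear _ _ s21));
  have -> : act (e i) s21 = e i + (odiff w + act (odiff w) s21).
  by rewrite -H addrA addrr_F2 add0r.
by rewrite -!addrA addrr_F2 addr0.
Qed.

(** Over F_2 a vanishing norm means that [e i] is invariant. *)
Lemma norm_neq0 i : projective (E 2%N) -> e i + act (e i) s21 <> 0.
Proof.
move=> Eproj H; apply: (@not_invariant i 0) => //; rewrite (lin0 (@dl 2)) addr0.
by rewrite -[LHS]add0r -(addrr_F2 (e i)) -addrA H addr0.
Qed.

(** This is the obstruction in degree 0, the only degree where the augmentation can be nonzero. The
    [Gz] terms vanish and the two [alpha] terms differ by a permutation. *)
Lemma augmentation_dG11 (G : nat -> nat -> E 4%N) : phi (dG G e 1 1) = 0.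
Proof.
have -> : dG G e 1 1 = alpha e 0 0 + act (alpha e 0 0) s3214.
  by rewrite /dG /Gz !(lin0 (@act_linear _ _ _)) !addr0 add0r.
by rewrite (linD (@phil 4)) augmentation_act addrr_F2.
Qed.

Variable L : levAC.

(* d(dG) = 0 in E because it holds in L: the map of graded operads from L to E
   sending G^a_k to its image for k <= n, and to 0 for k > n, commutes with the
   differentials of the elements occurring in dG^m_(n+1). *)
Lemma dG_cycle (G : nat -> nat -> E 4%N) m n :
  (forall a k, (1 <= a <= k)%N -> (k <= n)%N ->
     homog (- k%:Z) (G a k) /\ odiff (G a k) = dG G e a k) ->
  (1 <= m <= n.+1)%N -> odiff (dG G e m n.+1) = 0.
Proof.
move=> GP mn; pose G' a k := if (1 <= a <= k)%N && (k <= n)%N then G a k else 0.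
have G'E a k : (k <= n)%N -> Gz G' a k = Gz G a k.
  by move=> kn; rewrite /Gz /G' kn andbT; case: (0 < a <= k)%N.
have [|[f [fM fe fG]] _] := proj2 (lev_free L) E e G'.
  split=> // a k ak; rewrite /G' ak /=; case: ifP => [kn|_]; last exact: homog0.
  by have [] := GP _ _ ak kn.
have fl k := @operadMap_linear _ _ _ fM k.
have fdG a k : (k <= n)%N -> f 4 (dG (@levG L) (@leve L) a k.+1) = dG G e a k.+1.
  move=> kn; apply: operadMap_dG => // b; rewrite -G'E // /Gz.
  by case: ifP => [bk|_]; [exact: fG | exact: (lin0 (fl 4%N))].
have Q2 i : commutes f (leve L i).
  by rewrite /commutes lev_de fe de (linD (fl _)) (operadMap_act fM) !(operadMap_ez fM fe).
have QG a : commutes f (Gz (@levG L) a n).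
  rewrite /Gz; case: ifP => [an|_]; last exact: commutes0.
  rewrite /commutes (lev_dG L an) fG // /G' an leqnn /= (proj2 (GP _ _ an (leqnn n))).
  have n_gt0 : (0 < n)%N by case/andP: an => /leq_trans h /h.
  by rewrite -(prednK n_gt0) fdG // leq_pred.
(* A predicate is passed to [dG_param] as a relation that ignores its second argument. *)
pose R k (x _ : L k) : Prop := commutes f x.
have /eqP : R 4%N (dG (@levG L) (@leve L) m n.+1) (dG (@levG L) (@leve L) m n.+1).
  apply: (dG_param (R2 := @R 2%N) (R4 := @R 4%N)) => //; rewrite /R.
  - exact: commutes0.
  - by move=> x y s; exact: commutes_act.
  - exact: commutes0.
  - by move=> x x' y y' hx hy; rewrite -[x]scale1r; exact: commutesP.
  - by move=> c x y hx; rewrite -[c *: x]addr0; apply: commutesP => //; exact: commutes0.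
  - by move=> x y s; exact: commutes_act.
  - by move=> o o' x x' y y'; exact: commutes_comp2.
by rewrite fdG // -(lev_dG L mn) odiffK (lin0 (fl _)) => <-.
Qed.

(** The recursion runs on the lower index, for all upper indices at once, because [dG] in column
    [n.+1] depends only on column [n]. *)
Lemma exists_G : exists G : nat -> nat -> E 4%N, forall m n, (1 <= m <= n)%N ->
  homog (- n%:Z) (G m n) /\ odiff (G m n) = dG G e m n.
Proof.
have [prim primP] := primitive 4.
pose col := fix col n := if n is k.+1
  then fun m => prim (- k%:Z) (dG (fun a _ => col k a) e m k.+1) else fun=> 0.
exists (fun m n => col n m); pose G m n := col n m; rewrite -/G.
(* Inside the recursion the family ignores its second index; it agrees with [G] on column [n], which
   is all that [dG] reads. *)
have GS m n : G m n.+1 = prim (- n%:Z) (dG G e m n.+1).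
  rewrite {1}/G /=; congr prim.
  by apply: (dG_param (R2 := eq) (R4 := eq)) => // *; congruence.
suff H n a k : (1 <= a <= k)%N -> (k <= n)%N ->
    homog (- k%:Z) (G a k) /\ odiff (G a k) = dG G e a k.
  by move=> m n mn; exact: (H n).
elim: n a k => [|n IH] a k ak; first by rewrite leqn0 => /eqP k0; rewrite k0 leqn0 in ak;
  case: a ak.
rewrite leq_eqVlt => /orP[/eqP kE|]; last exact: IH.
subst k; rewrite GS; have -> : - n.+1%:Z = - n%:Z - 1 :> int.
  by rewrite -opprD -PoszD addn1.
have hd : homog (- n%:Z) (dG G e a n.+1).
  apply: dG_homog => // b; rewrite /Gz; case: ifP => [bn|_]; last exact: homog0.
  by have [] := IH _ _ bn (leqnn n).
apply: primP => //; first exact: dG_cycle.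
(* The obstruction has degree [- n], so the augmentation kills it unless [n = 0], and then
   [a = 1]. *)
case: n ak hd {IH} => [|n] ak hd; last exact: augmentation_homog hd.
have -> : a = 1%N by apply/eqP; rewrite eqn_leq andbC.
exact: augmentation_dG11.
Qed.

(* Modulo boundaries a cycle of L(2) is a multiple of e_0, and phi (e 0) = 1
   detects the coefficient. *)
Lemma quasiIso_arity2 (f : forall n, L n -> E n) :
  projective (E 2%N) -> isDgOperadMap f -> (forall i, f 2%N (leve L i) = e i) ->
  quasiIso (M := dgComponent L 2) (N := dgComponent E 2) (f 2%N).
Proof.
move=> Eproj [fM fd] fe; have fl := @operadMap_linear _ _ _ fM 2%N.
split=> [x dx [y fxE]|y dy].
  have [||||c [z xE]] := @arity2_cycle L (leve L) (@lev_de L) x.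
  - by have [[]] := lev_free L.
  - move=> i /(congr1 (f 2%N)); rewrite (linD fl) (operadMap_act fM) fe (lin0 fl).
    exact: norm_neq0.
  - exact: free_arity2_span (lev_free L).
  - exact: dx.
  exists z; move: fxE; rewrite xE (linD fl) (linZ fl) fe fd.
  move=> /(congr1 (@phi 2));
    rewrite (linD (@phil 2)) (linZ (@phil 2)) pe !augmentation_odiff addr0.
  have [c0|->] := F2_cases c; last by rewrite scale1r => /comMk1_neq0.
  by move=> _; rewrite c0 scale0r add0r.
(* For surjectivity, adding [c *: e 0] cancels the augmentation of [y], so the sum bounds and [y] is
   homologous to the image of [c *: leve L 0]. *)
pose c := comVal (phi y : comCar 2).
have [||z yE] := proj1 (phiW 2) (y + c *: e 0).
- have -> : diff (y + c *: e 0 : dgComponent E 2) = odiff y + c *: odiff (e 0).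
    by rewrite /= (linD (@dl 2)) (linZ (@dl 2)).
  by rewrite [odiff y]dy odiff_e0 // scaler0 addr0.
- exists 0; rewrite (linD (@phil 2)) (linZ (@phil 2)) pe.
  have -> : c *: comMk 2 1 = phi y.
    by have := comMk_linear 2 c 1 0; rewrite comMk0 !addr0 mulr1 comMkK.
  exact: addrr_F2.
exists (c *: leve L 0), z; split.
  by rewrite /= (linZ (@odiff_linear L 2)) odiff_e0 ?scaler0 //; exact: lev_de.
by rewrite (linZ fl) fe -yE addrCA addrr_F2 addr0.
Qed.
End Generators.

(** In arity two [Com] is the trivial module through [comVal], so the augmentation itself is the
    resolution. *)
Lemma projResolution_arity2 : projective (E 2%N) -> projResolutionF2 (dgComponent E 2%N).
Proof.
move=> Eproj; split=> //; exists (fun x => comVal (phi x : comCar 2)).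
have vl : linear (fun x : E 2%N => comVal (phi x : comCar 2) : ('F_2)^o).
  by move=> a x y; rewrite (@phil 2); exact: comVal_linear.
have v0 x : comVal (phi x : comCar 2) = 0 -> phi x = 0.
  by move=> h; rewrite -[LHS]comMkK h comMk0.
split.
- split; last by move=> x; rewrite [diff x]/= augmentation_odiff comVal0.
  split=> //; last by move=> x s; rewrite augmentation_act.
  move=> d x hx; have [->|d0] := eqVneq d 0; first by left.
  by right; rewrite (augmentation_homog d0 hx) comVal0.
- move=> c; have [x xE] := phiS (comMk 2 c); exists x.
  by rewrite xE comValK mulr1n.
split=> [x dx [y xE]|c _].
  by apply: (proj1 (phiW 2)) => //; exists 0; exact: v0.
have [x [z [dx xE]]] := proj2 (phiW 2) (comMk 2 c) erefl.
exists x, 0; split=> //; rewrite addr0 -[LHS](@comValK 2) xE.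
by rewrite addr0.
Qed.
End Einfty.

Theorem mainTheorem7 (L : levAC) (E : dgOperad) (hE : isEinfty E) :
  isAdemCartan L E.
Proof.
have [Eproj [phi [phiM phiS phiW]]] := hE.
split; first exact: projResolution_arity2 phiM phiS phiW (Eproj 2%N).
have [e [he pe de]] := exists_resolution_gens phiM phiW.
have [G GP] := exists_G phiM phiW he de L.
have [|[f [fM fe fG]] _] := proj2 (lev_free L) E e G.
  by split=> // m n /GP[].
have fl n := @operadMap_linear _ _ _ fM n.
have fdgM : isDgOperadMap f.
  split=> // n x; apply/eqP; suff: smem (commutesSubOperad fM) x by [].
  move: n x;
    apply: (free_operad_ind (S := commutesSubOperad fM) (lev_free L)) => [i|m n mn] /=.
    rewrite /commutes lev_de fe de (linD (fl _)) (operadMap_act fM).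
    by rewrite !(operadMap_ez fM fe).
  rewrite /commutes (lev_dG L mn) fG // (proj2 (GP _ _ mn)).
  (* The range [1 <= m <= n] excludes [n = 0], which gives the successor form needed by
     [operadMap_dG]. *)
  case: n mn => [|n] mn; first by case: m mn.
  rewrite (operadMap_dG fM fe (G' := G)) // => a; rewrite /Gz.
  by case: ifP => [an|_]; [exact: fG | exact: (lin0 (fl 4%N))].
exists f => //; exact: (quasiIso_arity2 phiM phiW pe de (Eproj 2%N) fdgM fe).
Qed.
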